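(* Let $I\subseteq\mathbb R[x_1,\dots,x_n]$ be an ideal such that $\mathcal V_{\mathbb R}(I)$ is compact. Then $\bigcap_{k\ge0}\mathrm{TH}_k(I)=\operatorname{cl}(\operatorname{conv}(\mathcal V_{\mathbb R}(I)))$.
   Context: $\mathbb{R}[\mathbf x]_k$ denotes the polynomials of degree at most $k$. $\mathcal V_{\mathbb R}(I)=\{x\in\mathbb R^n: f(x)=0\ \forall f\in I\}$. A polynomial $h$ is $k$-sos modulo $I$ if there are $g_1,\dots,g_r\in\mathbb{R}[\mathbf x]_k$ with $h-\sum_i g_i^2\in I$. The $k$-th theta body is $\mathrm{TH}_k(I)=\{p\in\mathbb R^n: l(p)\ge 0$ for every $l\in\mathbb{R}[\mathbf x]_1$ that is $k$-sos modulo $I\}$. *)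

(* Defs.v *)
From Stdlib Require Fin.
From Stdlib Require Import Reals List.
Open Scope R_scope.

Definition point (n : nat) := Fin.t n -> R.

(* Real polynomials in n variables, modelled as polynomial functions R^n -> R
   (R[x] is isomorphic to the ring of polynomial functions since R is infinite).
   polyk n k f  <->  f is (the function of) a polynomial of degree at most k,
   i.e. f lies in R[x]_k. *)
Inductive polyk (n : nat) : nat -> (point n -> R) -> Prop :=
  | polyk_const : forall k c, polyk n k (fun _ => c)
  | polyk_var : forall k (i : Fin.t n), (1 <= k)%nat -> polyk n k (fun x => x i)
  | polyk_add : forall k f g, polyk n k f -> polyk n k g ->
      polyk n k (fun x => f x + g x)
  | polyk_mul : forall k a b f g, polyk n a f -> polyk n b g -> (a + b <= k)%nat ->
      polyk n k (fun x => f x * g x).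

Definition is_poly (n : nat) (f : point n -> R) : Prop := exists k, polyk n k f.

Record is_ideal (n : nat) (I : (point n -> R) -> Prop) : Prop := {
  ideal_poly : forall f, I f -> is_poly n f;
  ideal_0 : I (fun _ => 0);
  ideal_add : forall f g, I f -> I g -> I (fun x => f x + g x);
  ideal_mul : forall f g, is_poly n f -> I g -> I (fun x => f x * g x)
}.

Definition VR (n : nat) (I : (point n -> R) -> Prop) (x : point n) : Prop :=
  forall f, I f -> f x = 0.

Fixpoint sum_sq (n : nat) (gs : list (point n -> R)) (x : point n) : R :=
  match gs with
  | nil => 0
  | g :: gs' => g x * g x + sum_sq n gs' x
  end.

Definition ksos_mod (n : nat) (I : (point n -> R) -> Prop) (k : nat)
    (h : point n -> R) : Prop :=
  exists gs : list (point n -> R),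
    (forall g, In g gs -> polyk n k g) /\
    I (fun x => h x - sum_sq n gs x).

Definition TH (n : nat) (k : nat) (I : (point n -> R) -> Prop) (p : point n) : Prop :=
  forall l, polyk n 1 l -> ksos_mod n I k l -> 0 <= l p.

(* Topology of R^n (sup-norm balls; same topology as the Euclidean one). *)
Definition is_open (n : nat) (U : point n -> Prop) : Prop :=
  forall x, U x -> exists eps, 0 < eps /\
    forall y, (forall i, Rabs (y i - x i) < eps) -> U y.

Definition is_compact (n : nat) (K : point n -> Prop) : Prop :=
  forall (J : Type) (U : J -> point n -> Prop),
    (forall j, is_open n (U j)) ->
    (forall x, K x -> exists j, U j x) ->
    exists l : list J, forall x, K x -> exists j, In j l /\ U j x.

Definition closure (n : nat) (S : point n -> Prop) (p : point n) : Prop :=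
  forall eps, 0 < eps -> exists q, S q /\ forall i, Rabs (p i - q i) < eps.

Definition conv (n : nat) (S : point n -> Prop) (p : point n) : Prop :=
  exists l : list (R * point n),
    (forall c, In c l -> 0 <= fst c /\ S (snd c)) /\
    fold_right (fun c acc => fst c + acc) 0 l = 1 /\
    forall i, p i = fold_right (fun c acc => fst c * snd c i + acc) 0 l.

(* Main.v *)
(* The substance is: a polynomial that is positive on the compact set V_R(I) is
   a sum of squares modulo I. An affine form separating a point from the closed
   convex hull can be taken positive on V_R(I), so it is then k-sos modulo I for
   some k, and it excludes the point from TH_k(I).

   Let T be the preorder of sums of squares modulo I. If f > 0 on V_R(I), the
   Positivstellensatz gives s, t in T with t f = 1 + s: otherwise T - f T is a
   proper preorder, so it is nonnegative under some ring homomorphism from the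
   polynomials to an ordered field, and by the Artin-Lang theorem there is a real
   point with the same signs, i.e. a point of V_R(I) at which f <= 0. Applied to
   f = N - |x|^2, Woermann's trick turns the identity into the archimedean
   property of T; for archimedean T the identity t f = 1 + s implies f in T.

   Artin-Lang is obtained by induction on the number of variables from a
   Cohen-Hoermander elimination step, which transfers the sign table of finitely
   many univariate polynomials from one ordered field to another. Instead of a
   real closure it uses an ordered extension in which a given polynomial has the
   largest possible number of roots. *)
From Stdlib Require Fin.
From Stdlib Require Import Reals.
From HB Require Import structures.
From mathcomp Require Import all_boot all_order all_algebra.
From mathcomp Require Import ring lra zify.
From mathcomp Require Import boolp classical_sets reals Rstruct polyrcf.
Require Import Defs.
Set Implicit Arguments.
Unset Strict Implicit.
Unset Printing Implicit Defensive.
Import Order.TTheory GRing.Theory Num.Theory.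
Local Open Scope ring_scope.

(** * Preorders and homomorphisms to ordered fields *)

(** The passage from a preorder to an ordered field is used at both ends: to give a polynomial a
    root in an ordered extension, starting from weighted sums of squares modulo that polynomial, and
    to turn a failing Positivstellensatz identity into a homomorphism. An elimination run inspects
    only finitely many polynomials. On the source side, real closedness can therefore be weakened to
    the intermediate value property for the divisors of these polynomials; it is arranged once they
    are known, by saturating their product. The target field is real closed from the start. The
    point found by Artin-Lang reproduces only finitely many signs, whereas a point of V_R(I) has to
    annihilate all of I. A separate induction on the number of variables shows that finitely many
    signs already force the whole kernel to vanish. *)

Record preorder (B : comNzRingType) (T : B -> Prop) : Prop := Preorder {
  preorderD : forall x y, T x -> T y -> T (x + y);
  preorderM : forall x y, T x -> T y -> T (x * y);
  preorder_sqr : forall x, T (x ^+ 2) }.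

Lemma preorder1 (B : comNzRingType) (T : B -> Prop) : preorder T -> T 1.
Proof. by move=> /preorder_sqr/(_ 1); rewrite expr1n. Qed.

Lemma preorder0 (B : comNzRingType) (T : B -> Prop) : preorder T -> T 0.
Proof. by move=> /preorder_sqr/(_ 0); rewrite expr0n. Qed.

Lemma preorder_adjoin (B : comNzRingType) (T : B -> Prop) (a : B) :
  preorder T -> preorder (fun x => exists s t, [/\ T s, T t & x = s + t * a]).
Proof.
move=> Tp; split.
- move=> _ _ [s [t [Ts Tt ->]]] [s' [t' [Ts' Tt' ->]]].
  exists (s + s'), (t + t'); split; [exact: (preorderD Tp)..|by ring].
- move=> _ _ [s [t [Ts Tt ->]]] [s' [t' [Ts' Tt' ->]]].
  exists (s * s' + t * t' * a ^+ 2), (s * t' + t * s').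
  split; [| |by ring]; apply: (preorderD Tp); do ?exact: (preorderM Tp).
  by apply: (preorderM Tp); [exact: (preorderM Tp)|exact: (preorder_sqr Tp)].
- move=> x; exists (x ^+ 2), 0; split; [exact: preorder_sqr Tp x| |by ring].
  exact: preorder0 Tp.
Qed.

Lemma preorder_adjoin_sub (B : comNzRingType) (T : B -> Prop) (a x : B) :
  preorder T -> T x -> exists s t, [/\ T s, T t & x = s + t * a].
Proof. by move=> Tp Tx; exists x, 0; split; [|exact: preorder0 Tp|by ring]. Qed.

Lemma preorder_adjoin_gen (B : comNzRingType) (T : B -> Prop) (a : B) :
  preorder T -> exists s t, [/\ T s, T t & a = s + t * a].
Proof.
by move=> Tp; exists 0, 1; split; [exact: preorder0 Tp|exact: preorder1 Tp|ring].
Qed.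

(** A point of the real spectrum of [B]: it amounts to a prime ideal, P ∩ -P, with an ordering of
    the residue domain. *)
Record cone (B : comNzRingType) := Cone {
  cone_pred :> B -> Prop;
  cone_preorder : preorder cone_pred;
  cone_total : forall x, cone_pred x \/ cone_pred (- x);
  coneN1 : ~ cone_pred (- 1);
  cone_prime : forall x y, cone_pred (x * y) -> cone_pred (- (x * y)) ->
     (cone_pred x /\ cone_pred (- x)) \/ (cone_pred y /\ cone_pred (- y)) }.

Lemma preorder_cone (B : comNzRingType) (T : B -> Prop) :
  preorder T -> ~ T (- 1) -> exists P : cone B, forall x, T x -> P x.
Proof.
move=> Tp TN1.
pose good (X : set B) := X = set0 \/
  [/\ preorder X, ~ X (- 1) & forall x, T x -> X x].
have [F Fgood Ftot|P [Pgood Pmax]] := @Zorn_bigcup B good.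
  have [[X0 [FX0 [x0 X0x0]]]|nF] :=
      pselect (exists X, F X /\ exists x, X x); last first.
    left; apply/seteqP; split=> // x [X FX Xx]; case: nF.
    by exists X; split=> //; exists x.
  have gF X x : F X -> X x -> [/\ preorder X, ~ X (- 1) & forall x, T x -> X x].
    by move=> FX Xx; case: (Fgood X FX) => [X0E|//]; rewrite X0E in Xx.
  right; split.
  - split.
    + move=> x y [X FX Xx] [Y FY Yy].
      case: (Ftot _ _ FX FY) => [XY|YX].
        by exists Y => //; have [/preorderD + _ _] := gF _ _ FY Yy; apply=> //; exact: XY.
      by exists X => //; have [/preorderD + _ _] := gF _ _ FX Xx; apply=> //; exact: YX.
    + move=> x y [X FX Xx] [Y FY Yy].
      case: (Ftot _ _ FX FY) => [XY|YX].
        by exists Y => //; have [/preorderM + _ _] := gF _ _ FY Yy; apply=> //; exact: XY.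
      by exists X => //; have [/preorderM + _ _] := gF _ _ FX Xx; apply=> //; exact: YX.
    + by move=> x; exists X0 => //; have [/preorder_sqr + _ _] := gF _ _ FX0 X0x0; apply.
  - by move=> [X FX Xx]; have [_ + _] := gF _ _ FX Xx.
  - by move=> x Tx; exists X0 => //; have [_ _ +] := gF _ _ FX0 X0x0; apply.
have [Pp PN1 TP] : [/\ preorder P, ~ P (- 1) & forall x, T x -> P x].
  case: Pgood => // P0; case: (Pmax T); last by right.
  split; first by rewrite P0.
  by move=> /(_ 0 (preorder0 Tp)); rewrite P0.
have adj a : ~ P a -> exists s t, [/\ P s, P t & - 1 = s + t * a].
  move=> Pa; apply: contrapT => h.
  apply: (Pmax (fun x => exists s t, [/\ P s, P t & x = s + t * a])).
    split; first by move=> x Px; exact: preorder_adjoin_sub.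
    by move=> /(_ _ (preorder_adjoin_gen a Pp)).
  right; split; [exact: preorder_adjoin|exact: h|].
  by move=> x /TP Px; exact: preorder_adjoin_sub.
(* Multiplying t x = -1 - s by t' y = -1 - s' gives t t' x y = 1 + s + s' + s s', so -(x y) in P
   would put -1 into P. Totality is the case y = -x. *)
have Pmul x y : ~ P x -> ~ P y -> P (- (x * y)) -> False.
  move=> /adj[s [t [Ps Pt E1]]] /adj[s' [t' [Ps' Pt' E2]]] Pxy.
  have Nxy : - 1 = s + s' + s * s' + t * t' * (- (x * y)).
    have e1 : t * x = - 1 - s by rewrite E1; ring.
    have e2 : t' * y = - 1 - s' by rewrite E2; ring.
    transitivity (s + s' + s * s' - (t * x) * (t' * y)); last by ring.
    by rewrite e1 e2; ring.
  apply: PN1; rewrite Nxy.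
  apply: (preorderD Pp); last by do 2?[apply: (preorderM Pp)].
  by do 2?[apply: (preorderD Pp)] => //; exact: (preorderM Pp).
have Ptot x : P x \/ P (- x).
  apply: contrapT => /not_orP[h1 h2]; apply: (Pmul _ _ h1 h2).
  by rewrite mulrN opprK -expr2; exact: (preorder_sqr Pp).
have Pprime x y : P (x * y) -> P (- (x * y)) ->
    (P x /\ P (- x)) \/ (P y /\ P (- y)).
  move=> h1 h2; apply: contrapT => /not_orP[/not_andP hx /not_andP hy].
  case: hx => hx; case: hy => hy.
  - exact: Pmul hx hy h2.
  - by apply: (Pmul _ _ hx hy); rewrite mulrN opprK.
  - by apply: (Pmul _ _ hx hy); rewrite mulNr opprK.
  - by apply: (Pmul _ _ hx hy); rewrite mulrNN.
by exists (Cone Pp Ptot PN1 Pprime).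
Qed.

Lemma fraction_tofrac (D : idomainType) (f : {fraction D}) :
  exists n d : D, d != 0 /\ f = FracField.tofrac n / FracField.tofrac d.
Proof.
elim/quotW: f => -[[n d] /= d0]; exists n, d; split => //.
apply: (canRL (mulfK _)); first by rewrite tofrac_eq0.
rewrite !piE; apply/eqmodP.
by rewrite /= FracField.equivfE !numden_Ratio ?mulr1 ?oner_neq0 //= mulrC.
Qed.

(** * The residue field of a cone *)

Section ConeField.
Variables (B : comNzRingType) (P : cone B).
Implicit Types x y : B.

Definition cone_supp : {pred B} := fun x => `[< P x /\ P (- x) >].

Lemma cone_suppP x : reflect (P x /\ P (- x)) (x \in cone_supp).
Proof. exact: asboolP. Qed.

Let Pp := cone_preorder P.

Lemma cone_supp_idealr : idealr_closed cone_supp.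
Proof.
split.
- by apply/cone_suppP; rewrite oppr0; split; exact: preorder0 Pp.
- by apply/cone_suppP => -[_ /coneN1].
- move=> a u v /cone_suppP[u1 u2] /cone_suppP[v1 v2]; apply/cone_suppP.
  rewrite opprD; split; apply: (preorderD Pp) => //.
    case: (cone_total P a) => Pa; first exact: (preorderM Pp).
    by rewrite -mulrNN; exact: (preorderM Pp).
  case: (cone_total P a) => Pa; first by rewrite -mulrN; exact: (preorderM Pp).
  by rewrite -mulNr; exact: (preorderM Pp).
Qed.

HB.instance Definition _ := isIdealr.Build B cone_supp cone_supp_idealr.

Lemma cone_supp_prime : prime_idealr_closed cone_supp.
Proof.
move=> u v /cone_suppP[h1 h2]; apply/orP.
by case: (cone_prime h1 h2) => h; [left|right]; apply/cone_suppP.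
Qed.

HB.instance Definition _ := isPrimeIdealrClosed.Build B cone_supp cone_supp_prime.

Definition cone_quot := {ideal_quot cone_supp}.
HB.instance Definition _ := GRing.ComNzRing.on cone_quot.

Definition cone_pi : {rmorphism B -> cone_quot} := \pi_cone_quot%qT.

Lemma cone_pi_eq0 x : (cone_pi x == 0) = (x \in cone_supp).
Proof. by rewrite -(rmorph0 cone_pi) -Quotient.idealrBE subr0. Qed.

Lemma cone_piP (u : cone_quot) : exists x, u = cone_pi x.
Proof. by exists (repr u); rewrite /cone_pi /= reprK. Qed.

(** Units and inverses are chosen classically: they are part of the data of an [idomainType], over
    which the fraction field is formed. *)
Definition cone_quot_unit : {pred cone_quot} := fun u => `[< exists v, v * u = 1 >].

Definition cone_quot_inv (u : cone_quot) : cone_quot :=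
  if pselect (exists v, v * u = 1) is left h then projT1 (cid h) else u.

Lemma cone_quot_mulV : {in cone_quot_unit, left_inverse 1 cone_quot_inv *%R}.
Proof.
by move=> u /asboolP h; rewrite /cone_quot_inv; case: pselect => // h'; case: cid.
Qed.

Lemma cone_quot_unitP (u v : cone_quot) : v * u = 1 -> u \in cone_quot_unit.
Proof. by move=> h; apply/asboolP; exists v. Qed.

Lemma cone_quot_inv_out : {in [predC cone_quot_unit], cone_quot_inv =1 id}.
Proof.
move=> u; rewrite inE => /asboolP h; rewrite /cone_quot_inv.
by case: pselect => // h'; case: h.
Qed.

HB.instance Definition _ := GRing.ComNzRing_hasMulInverse.Build cone_quot
  cone_quot_mulV cone_quot_unitP cone_quot_inv_out.

Lemma cone_quot_integral (u v : cone_quot) : u * v = 0 -> (u == 0) || (v == 0).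
Proof. exact: Quotient.rquot_IdomainAxiom. Qed.

HB.instance Definition _ := GRing.ComUnitRing_isIntegral.Build cone_quot
  cone_quot_integral.

Definition cone_field := {fraction cone_quot}.
HB.instance Definition _ := GRing.Field.on cone_field.

Definition cone_embed : {rmorphism B -> cone_field} :=
  (@FracField.tofrac cone_quot : {rmorphism _ -> _}) \o cone_pi.

Lemma cone_embed_eq0 x : (cone_embed x == 0) = (x \in cone_supp).
Proof. by rewrite /cone_embed /= tofrac_eq0 cone_pi_eq0. Qed.

Lemma cone_fieldP (f : cone_field) :
  exists x y, cone_embed y != 0 /\ f = cone_embed x / cone_embed y.
Proof.
have [n [d [d0 ->]]] := fraction_tofrac f.
have [x xE] := cone_piP n; have [y yE] := cone_piP d.
by exists x, y; rewrite cone_embed_eq0 -cone_pi_eq0 /cone_embed /= -xE -yE.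
Qed.

End ConeField.

Section OrderedFractionField.
Variables (B : comNzRingType) (P : cone B) (K : fieldType) (e : {rmorphism B -> K}).
Hypothesis e_eq0 : forall x, (e x == 0) = (x \in cone_supp P).
Hypothesis eP : forall f, exists x y, e y != 0 /\ f = e x / e y.
Implicit Types (x y : B) (f g : K).
Let Pp := cone_preorder P.

Lemma frac_neq0 y : e y != 0 -> ~ (P y /\ P (- y)).
Proof. by rewrite e_eq0 => /cone_suppP. Qed.

(** If -a were in P, then a y^2 would lie in the support, which is prime and does not contain y; so
    a would lie in it too. *)
Lemma cone_cancel_sqr a y : e y != 0 -> P (a * y ^+ 2) -> P a.
Proof.
move=> /frac_neq0 y0 Pay; case: (cone_total P a) => // PNa.
have PNay : P (- (a * y ^+ 2)).
  by rewrite -mulNr; apply: (preorderM Pp) => //; exact: (preorder_sqr Pp).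
case: (cone_prime Pay PNay) => [[]//|[y2 Ny2]].
by rewrite expr2 in y2 Ny2; case: (cone_prime y2 Ny2).
Qed.

Lemma cone_supp_congr a b : P a -> e a = e b -> P b.
Proof.
move=> Pa ab; have : e (b - a) == 0 by rewrite rmorphB ab subrr.
rewrite e_eq0 => /cone_suppP[h _].
by rewrite -(subrK a b); exact: (preorderD Pp).
Qed.

(** The fraction x / y has the sign of x y, because the two differ by the factor y^2. *)
Definition cone_nneg (f : K) : bool :=
  `[< exists x y, [/\ e y != 0, f = e x / e y &
      P (x * y)] >].

Lemma cone_nnegE x y : e y != 0 ->
  cone_nneg (e x / e y) <-> P (x * y).
Proof.
move=> y0; split; last by move=> Pxy; apply/asboolP; exists x, y.
move=> /asboolP[x' [y' [y'0 E Pxy']]].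
have {}E : e (x * y') = e (x' * y).
  by move: E => /eqP; rewrite eqr_div // => /eqP E; rewrite !rmorphM.
apply: (@cone_cancel_sqr _ y') => //.
apply: (@cone_supp_congr (x' * y' * y ^+ 2)).
  by apply: (preorderM Pp) => //; exact: (preorder_sqr Pp).
transitivity (e (x' * y) * e (y * y')); last rewrite -E.
  by rewrite -rmorphM; congr (e _); ring.
by rewrite -rmorphM; congr (e _); ring.
Qed.

Lemma frac_nneg x : cone_nneg (e x) <-> P x.
Proof.
have := @cone_nnegE x 1; rewrite rmorph1 divr1 mulr1 oner_neq0; exact.
Qed.

Lemma cone_nnegD f g : cone_nneg f -> cone_nneg g -> cone_nneg (f + g).
Proof.
have [x [y [y0 ->]]] := eP f; have [x' [y' [y'0 ->]]] := eP g.
move=> /(cone_nnegE _ y0) h /(cone_nnegE _ y'0) h'.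
rewrite addf_div // -!rmorphM -rmorphD; apply/cone_nnegE.
  by rewrite rmorphM mulf_neq0.
have -> : (x * y' + x' * y) * (y * y') = (x * y) * y' ^+ 2 + (x' * y') * y ^+ 2.
  by ring.
by apply: (preorderD Pp); apply: (preorderM Pp) => //; exact: (preorder_sqr Pp).
Qed.

Lemma cone_nnegM f g : cone_nneg f -> cone_nneg g -> cone_nneg (f * g).
Proof.
have [x [y [y0 ->]]] := eP f; have [x' [y' [y'0 ->]]] := eP g.
move=> /(cone_nnegE _ y0) h /(cone_nnegE _ y'0) h'.
rewrite mulf_div -!rmorphM; apply/cone_nnegE.
  by rewrite rmorphM mulf_neq0.
have -> : (x * x') * (y * y') = (x * y) * (x' * y') by ring.
exact: (preorderM Pp).
Qed.

Lemma cone_nneg_total f : cone_nneg f || cone_nneg (- f).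
Proof.
have [x [y [y0 ->]]] := eP f; rewrite -mulNr -rmorphN; apply/orP.
case: (cone_total P (x * y)) => h; [left|right]; apply/cone_nnegE => //.
by rewrite mulNr.
Qed.

Lemma cone_nneg_anti f : cone_nneg f -> cone_nneg (- f) -> f = 0.
Proof.
have [x [y [y0 ->]]] := eP f; rewrite -mulNr -rmorphN.
move=> /(cone_nnegE _ y0) h /(cone_nnegE _ y0); rewrite mulNr => h'.
 case: (cone_prime h h') => [hx|]; last first.
  by move=> hy; case: (frac_neq0 y0).
suff /eqP -> : e x == 0 by rewrite mul0r.
by rewrite e_eq0; exact/cone_suppP.
Qed.

Definition cone_norm (f : K) := if cone_nneg f then f else - f.

Lemma cone_normN f : cone_norm (- f) = cone_norm f.
Proof.
rewrite /cone_norm opprK; case: ifPn => h; case: ifPn => h' //.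
  by rewrite (cone_nneg_anti h' h) oppr0.
by have := cone_nneg_total f; rewrite (negPf h) (negPf h').
Qed.

Definition cone_le (f g : K) := cone_nneg (g - f).

Lemma cone_le0D f g : cone_le 0 f -> cone_le 0 g -> cone_le 0 (f + g).
Proof. by rewrite /cone_le !subr0; exact: cone_nnegD. Qed.
Lemma cone_le0M f g : cone_le 0 f -> cone_le 0 g -> cone_le 0 (f * g).
Proof. by rewrite /cone_le !subr0; exact: cone_nnegM. Qed.
Lemma cone_le0_anti f : cone_le 0 f -> cone_le f 0 -> f = 0.
Proof. by rewrite /cone_le subr0 sub0r; exact: cone_nneg_anti. Qed.
Lemma cone_sub_ge0 f g : cone_le 0 (g - f) = cone_le f g.
Proof. by rewrite /cone_le subr0. Qed.
Lemma cone_le0_total f : cone_le 0 f || cone_le f 0.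
Proof. by rewrite /cone_le subr0 sub0r; exact: cone_nneg_total. Qed.
Lemma cone_ge0_norm f : cone_le 0 f -> cone_norm f = f.
Proof. by rewrite /cone_le subr0 /cone_norm => ->. Qed.

Lemma cone_ordered_field :
  exists (F : realFieldType) (pi : {rmorphism B -> F}), forall x, P x -> 0 <= pi x.
Proof.
pose F : realFieldType := HB.pack K (Num.IntegralDomain_isLeReal.Build K
  cone_le0D cone_le0M cone_le0_anti cone_sub_ge0 cone_le0_total cone_normN
  cone_ge0_norm (fun _ _ => erefl)).
exists F, e => x Px.
change (cone_le 0 (e x)); rewrite /cone_le subr0; exact/frac_nneg.
Qed.

End OrderedFractionField.

Lemma preorder_field (B : comNzRingType) (T : B -> Prop) :
  preorder T -> ~ T (- 1) ->
  exists (F : realFieldType) (pi : {rmorphism B -> F}), forall x, T x -> 0 <= pi x.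
Proof.
move=> Tp TN1; have [P TP] := preorder_cone Tp TN1.
have [F [pi piP]] := cone_ordered_field (@cone_embed_eq0 _ P) (@cone_fieldP _ P).
by exists F, pi => x /TP; exact: piP.
Qed.

(** * Adjoining roots to ordered fields *)

Definition order_hom (E F : realFieldType) (f : E -> F) :=
  forall x, 0 <= x -> 0 <= f x.

Lemma order_hom_sgz (E F : realFieldType) (f : {rmorphism E -> F}) :
  order_hom f -> forall x, sgz (f x) = sgz x.
Proof.
move=> fP x; case: (sgzP x) => [->|x0|x0]; first by rewrite rmorph0 sgz0.
  by apply: gtr0_sgz; rewrite lt_neqAle eq_sym fmorph_eq0 gt_eqF //= fP // ltW.
apply: ltr0_sgz; rewrite -oppr_gt0 -rmorphN lt_neqAle eq_sym fmorph_eq0 oppr_eq0.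
by rewrite lt_eqF //= fP // oppr_ge0 ltW.
Qed.

Lemma rmorph_poly_horner (A : nzRingType) (F : comNzRingType)
    (f : {rmorphism {poly A} -> F}) (q : {poly A}) :
  (map_poly (f \o polyC) q).[f 'X] = f q.
Proof.
elim/poly_ind: q => [|p c IHp]; first by rewrite !rmorph0 horner0.
by rewrite !rmorphD /= !rmorphM /= map_polyX map_polyC hornerMXaddC IHp.
Qed.

(** The weights stand in for square roots: a nonnegative element of [E] need not be a square, yet it
    has to stay nonnegative in the extension. *)
Inductive wsos (E : realFieldType) : {poly E} -> Prop :=
  | wsos0 : wsos 0
  | wsosD (c : E) (h f : {poly E}) : 0 <= c -> wsos f -> wsos (c *: h ^+ 2 + f).

Section WeightedSumOfSquares.
Variable E : realFieldType.
Implicit Types (f g h u : {poly E}).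

Lemma wsos_add f g : wsos f -> wsos g -> wsos (f + g).
Proof.
elim=> [|c h {}f c0 _ IHf] Sg; first by rewrite add0r.
by rewrite -addrA; apply: wsosD => //; exact: IHf.
Qed.

Lemma wsos_scale c h f : 0 <= c -> wsos f -> wsos (c *: h ^+ 2 * f).
Proof.
move=> c0; elim=> [|d k {}f d0 _ IHf]; first by rewrite mulr0; exact: wsos0.
rewrite mulrDr -scalerAl -scalerAr scalerA -exprMn.
by apply: wsosD => //; rewrite mulr_ge0.
Qed.

Lemma wsos_mul f g : wsos f -> wsos g -> wsos (f * g).
Proof.
move=> + Sg; elim=> [|c h {}f c0 _ IHf]; first by rewrite mul0r; exact: wsos0.
by rewrite mulrDl; apply: wsos_add IHf; exact: wsos_scale.
Qed.

Lemma wsos_sqr h : wsos (h ^+ 2).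
Proof.
by rewrite -[X in wsos X]addr0 -[h ^+ 2]scale1r; apply: wsosD => //; exact: wsos0.
Qed.

Lemma wsos_ge0 (F : realFieldType) (i : {rmorphism E -> F}) f y :
  order_hom i -> wsos f -> 0 <= (map_poly i f).[y].
Proof.
move=> iP; elim=> [|c h {}f c0 _ IHf]; first by rewrite rmorph0 horner0.
rewrite rmorphD hornerD /= map_polyZ hornerZ rmorphXn horner_exp.
by rewrite addr_ge0 // mulr_ge0 ?sqr_ge0 // iP.
Qed.

(** Replacing each h by its remainder modulo g leaves degree at most 2 deg g - 2, so that the
    cofactor k in 1 + u' = k g has smaller degree than g. *)
Lemma wsos_mod g u : (1 < size g)%N -> wsos u ->
  exists u', [/\ wsos u', g %| u - u' & (size u' + 2 < 2 * size g)%N].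
Proof.
move=> g1; have g0 : g != 0 by rewrite -size_poly_gt0; lia.
elim=> [|c h f c0 _ [u' [Su' dvd szu']]].
  exists 0; split; [exact: wsos0|by rewrite subr0 dvdp0|rewrite size_poly0; lia].
exists (c *: (h %% g) ^+ 2 + u'); split; first exact: wsosD.
  have -> : c *: h ^+ 2 + f - (c *: (h %% g) ^+ 2 + u') =
     c *: ((h - h %% g) * (h + h %% g)) + (f - u').
    by rewrite -subr_sqr scalerBr; ring.
  apply: dvdp_add => //; rewrite -mul_polyC; apply: dvdp_mull; apply: dvdp_mulr.
  by rewrite {1}(divp_eq h g) addrK dvdp_mull.
have hg := ltn_modpN0 h g0.
have s1 : (size (c *: (h %% g) ^+ 2) <= (size ((h %% g) ^+ 2)))%N.
  exact: size_scale_leq.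
have s2 := size_poly_exp_leq (h %% g) 2.
apply: leq_ltn_trans (leq_add (size_polyD _ _) (leqnn 2)) _.
rewrite addn_maxl gtn_max szu' andbT.
move: (leq_trans s1 s2) hg g1; clear.
move: (size (h %% g)) (size g) (size _) => x y z.
lia.
Qed.
End WeightedSumOfSquares.

Lemma ivt_size (E : realFieldType) (g : {poly E}) a b :
  g.[a] * g.[b] < 0 -> (1 < size g)%N.
Proof.
move=> gab; rewrite ltnNge; apply/negP => /size1_polyC gE.
by move: gab; rewrite gE !hornerC ltNge -expr2 sqr_ge0.
Qed.

(** If -1 is not a weighted sum of squares modulo g, an ordered residue field of E[X]/(g) contains
    the root. Otherwise 1 + u' = k g; by induction k has a root in some ordered extension, and there
    u' would equal -1 although it is nonnegative. *)
Lemma sign_change_root (E : realFieldType) (g : {poly E}) a b :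
  g.[a] * g.[b] < 0 ->
  exists (F : realFieldType) (i : {rmorphism E -> F}) (y : F),
    order_hom i /\ root (map_poly i g) y.
Proof.
have [m] := ubnP (size g); elim: m => // m IHm in g a b * => szg gab.
have g1 := ivt_size gab.
have g0 : g != 0 by rewrite -size_poly_gt0; lia.
pose T f := exists u, wsos u /\ g %| f - u.
have Tp : preorder T.
  split.
  - move=> x y [u [Su gu]] [v [Sv gv]]; exists (u + v).
    split; first exact: wsos_add.
    by rewrite opprD addrACA dvdp_add.
  - move=> x y [u [Su gu]] [v [Sv gv]]; exists (u * v).
    split; first exact: wsos_mul.
    have -> : x * y - u * v = (x - u) * y + u * (y - v) by ring.
    by apply: dvdp_add; [exact: dvdp_mulr|exact: dvdp_mull].
  - by move=> x; exists (x ^+ 2); rewrite subrr dvdp0; split=> //; exact: wsos_sqr.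
have TN1 : ~ T (- 1).
  move=> [u [Su gu]]; have [u' [Su' guu' szu']] := wsos_mod g1 Su.
  have : g %| 1 + u'.
    have e : - (1 + u') = (- 1 - u) + (u - u') by ring.
    by rewrite -dvdpNr e; exact: dvdp_add.
  move=> /dvdpP[k kE].
  have pos x : 0 < (k * g).[x].
    rewrite -kE hornerD hornerC ltr_wpDr //.
    by have := wsos_ge0 (i := idfun) x (fun _ => id) Su'; rewrite map_poly_id.
  (* the cofactor k changes sign too, and has smaller degree than g *)
  have kab : k.[a] * k.[b] < 0.
    have ha := pos a; have hb := pos b; rewrite !hornerM in ha hb.
    have : 0 < (k.[a] * k.[b]) * (g.[a] * g.[b]) by rewrite mulrACA mulr_gt0.
    by rewrite nmulr_lgt0.
  have k0 : k != 0 by apply/eqP => k0; rewrite k0 !horner0 mul0r ltxx in kab.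
  have szk : (size k < m)%N.
    have := size_polyD 1 u'; rewrite kE size_mul // size_poly1 leq_max.
    move: szu' szg g1; clear; move: (size k) (size g) (size u') => x y z.
    lia.
  have [F [i [y [iP rk]]]] := IHm _ _ _ szk kab.
  have := wsos_ge0 y iP Su'.
  have -> : u' = k * g - 1 by rewrite -kE; ring.
  rewrite rmorphB rmorphM rmorph1 hornerD hornerM (eqP rk) mul0r hornerN hornerC.
  by rewrite add0r oppr_ge0 ler10.
have [F [pi piP]] := preorder_field Tp TN1.
have pig : pi g = 0.
  apply/eqP; rewrite eq_le -oppr_ge0 -rmorphN !piP //.
    by exists 0; split; [exact: wsos0|rewrite subr0].
  by exists 0; split; [exact: wsos0|rewrite subr0 dvdpNr].
exists F, (pi \o polyC), (pi 'X); split.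
  move=> x x0 /=; apply: piP; exists x%:P; rewrite subrr dvdp0; split=> //.
  rewrite -[x%:P]addr0 -[x%:P]mulr1 mul_polyC -[1](expr1n _ 2).
  by apply: wsosD => //; exact: wsos0.
by rewrite /root rmorph_poly_horner pig.
Qed.

(* [q] already has in [E] all the roots it can acquire in an ordered extension. *)
Definition saturated (E : realFieldType) (q : {poly E}) :=
  forall (F : realFieldType) (i : {rmorphism E -> F}) y, order_hom i ->
    root (map_poly i q) y -> exists x, y = i x.

Lemma saturated_dvdp (E : realFieldType) (p q : {poly E}) :
  p %| q -> saturated q -> saturated p.
Proof.
move=> /dvdpP[r ->] Gq F i y iP yp; apply: Gq iP _.
by rewrite rmorphM rootM yp orbT.
Qed.

(** Each failure of saturation supplies a new root in a larger field, and the degree bounds how many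
    there can be. *)
Lemma saturated_ext (E : realFieldType) (q : {poly E}) : q != 0 ->
  exists (F : realFieldType) (i : {rmorphism E -> F}),
    order_hom i /\ saturated (map_poly i q).
Proof.
move=> q0.
suff H m : forall (F : realFieldType) (i : {rmorphism E -> F}) (rs : seq F),
    order_hom i -> uniq rs -> all (root (map_poly i q)) rs ->
    (size q <= size rs + m)%N ->
    exists (F : realFieldType) (i : {rmorphism E -> F}),
    order_hom i /\ saturated (map_poly i q).
  by apply: (H (size q) E idfun [::]).
elim: m => [|m IHm] F i rs iP urs rrs szq.
  have := max_poly_roots (_ : map_poly i q != 0) rrs urs.
  by rewrite map_poly_eq0 size_map_poly ltnNge -(addn0 (size rs)) szq => /(_ q0).
have [G|nG] := pselect (saturated (map_poly i q)); first by exists F, i.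
move: nG => /existsNP[F' /existsNP[j /existsNP[y]]].
move=> /not_implyP[jP] /not_implyP[ry] ny.
apply: (IHm F' (j \o i) (y :: map j rs)).
- by move=> x x0 /=; apply/jP/iP.
- rewrite /= map_inj_uniq ?urs ?andbT; last exact: fmorph_inj.
  by apply/negP => /mapP[x _ yE]; apply: ny; exists x.
- rewrite map_poly_comp /= ry all_map; apply: sub_all rrs => x /=.
  by rewrite fmorph_root.
- by rewrite /= size_map addSnnS.
Qed.

(* Quantifying over the divisors of [q] makes Rolle's theorem provable, by applying
   the intermediate value property to cofactors of [q] and of its derivative. *)
Definition ivt_dvd (E : realFieldType) (q : {poly E}) :=
  forall f, f %| q -> forall a b, a < b -> f.[a] * f.[b] < 0 ->
  exists c, [/\ a < c, c < b & root f c].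

(** A sign change yields a root in [E], but perhaps not between a and b. A root outside the interval
    is divided out: its linear factor has constant sign on the interval, so the cofactor still
    changes sign. *)
Lemma saturated_ivt (E : realFieldType) (q : {poly E}) : saturated q -> ivt_dvd q.
Proof.
move=> satq f fq a b ab.
have {q satq fq} satf := saturated_dvdp fq satq.
have [m] := ubnP (size f); elim: m => // m IHm in f satf * => szf fab.
have f0 : f != 0 by apply/eqP => f0; move: fab; rewrite f0 !horner0 mul0r ltxx.
have [[r rr]|nr] := pselect (exists r, root f r); last first.
  have [F [i [y [iP ry]]]] := sign_change_root fab.
  have [x yE] := satf _ _ _ iP ry; case: nr; exists x.
  by move: ry; rewrite yE fmorph_root.
have [arb|narb] := boolP ((a < r) && (r < b)).
  by exists r; case/andP: arb.
have /factor_theorem[g fE] := rr; rewrite fE in szf f0 fab satf.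
rewrite !hornerM !hornerXsubC in fab.
have ar : a != r by apply/eqP => h; move: fab; rewrite h subrr mulr0 mul0r ltxx.
have br : b != r by apply/eqP => h; move: fab; rewrite h subrr !mulr0 ltxx.
have gab : g.[a] * g.[b] < 0.
  move: fab; rewrite mulrACA pmulr_llt0 //.
  have [ra|ra|ra] := ltgtP a r; last by rewrite ra eqxx in ar.
    rewrite ra /= -leNgt le_eqVlt (negPf br) /= in narb.
    by rewrite nmulr_rgt0 subr_lt0.
  by rewrite mulr_gt0 // subr_gt0 // (lt_trans ra).
have [||c [ac cb rc]] := IHm g _ _ gab.
- exact: saturated_dvdp (dvdp_mulr _ (dvdpp g)) satf.
- have g0 : g != 0 by apply: contraNneq f0 => ->; rewrite mul0r.
  by move: szf; rewrite size_Mmonic ?monicXsubC // size_XsubC addn2.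
- by exists c; split=> //; rewrite fE rootM rc.
Qed.

(** * Signs, roots and derivatives under the intermediate value property *)

Lemma ivt_sgz (E : realFieldType) (q : {poly E}) x y : ivt_dvd q ->
  (forall c, root q c -> sgz (x - c) = sgz (y - c)) -> sgz q.[x] = sgz q.[y].
Proof.
move=> ivt.
wlog xy : x y / x < y => [hw|] h.
  have [xy|yx|->//] := ltgtP x y; first exact: hw.
  by apply/esym/hw => // c rc; rewrite h.
have noroot c : x <= c <= y -> ~~ root q c.
  move=> /andP[xc cy]; apply/negP => /h.
  have := xc; rewrite -subr_le0 -sgz_le0 => + e; rewrite e sgz_le0 subr_le0 => yc.
  move: e; have -> : c = y by apply/le_anti; rewrite cy yc.
  by rewrite subrr sgz0 => /eqP; rewrite sgz_eq0 subr_eq0 lt_eqF.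
have qx : q.[x] != 0 by apply: noroot; rewrite lexx ltW.
have qy : q.[y] != 0 by apply: noroot; rewrite lexx ltW.
have [neg|] := ltP (q.[x] * q.[y]) 0.
  have [c [xc cy rc]] := ivt q (dvdpp q) _ _ xy neg.
  by have := noroot c; rewrite !ltW // rc; move=> /(_ isT).
rewrite le_eqVlt eq_sym mulf_eq0 (negPf qx) (negPf qy) /=.
rewrite -sgz_gt0 sgzM.
by move: qx qy; do 2!case: sgzP.
Qed.

Lemma seq_max_bound (E : realFieldType) (s : seq E) :
  s = [::] \/ exists2 m, m \in s & forall x, x \in s -> x <= m.
Proof.
elim: s => [|a s [->|[m ms mP]]]; [by left|right|right].
  by exists a => [|x]; rewrite ?inE // => /eqP ->.
have [am|ma] := leP a m.
  exists m; first by rewrite inE ms orbT.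
  by move=> x; rewrite inE => /orP[/eqP->//|/mP].
exists a; first by rewrite inE eqxx.
by move=> x; rewrite inE => /orP[/eqP->//|/mP xm]; rewrite (le_trans xm) ?ltW.
Qed.

Lemma seq_min_bound (E : realFieldType) (s : seq E) :
  s = [::] \/ exists2 m, m \in s & forall x, x \in s -> m <= x.
Proof.
have [|[m ms mP]] := seq_max_bound (map -%R s); first by case: s => //; left.
right; exists (- m); first by move/mapP: ms => [x xs ->]; rewrite opprK.
by move=> x xs; rewrite lerNl mP // map_f.
Qed.

Lemma finite_roots (E : realFieldType) (q : {poly E}) : q != 0 ->
  exists rs : seq E, forall x, root q x = (x \in rs).
Proof.
have [m] := ubnP (size q); elim: m => // m IHm in q * => szq q0.
have [[r rr]|nr] := pselect (exists r, root q r); last first.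
  by exists [::] => x; rewrite in_nil; apply/negP => rx; case: nr; exists x.
have /factor_theorem[g qE] := rr; rewrite qE in szq q0 *.
have g0 : g != 0 by apply: contraNneq q0 => ->; rewrite mul0r.
have [|//|rs rsP] := IHm g.
  by move: szq; rewrite size_Mmonic ?monicXsubC // size_XsubC addn2.
by exists (r :: rs) => x; rewrite rootM rsP root_XsubC inE orbC.
Qed.

(** The argument is algebraic, without extrema: with d the first root after a, q = (X - a)^(i+1) (X
    - d)^(j+1) g, where g has the same sign at a and d, and the corresponding factor of q' has
    opposite signs there. *)
Lemma ivt_rolle (E : realFieldType) (q : {poly E}) a b :
  q != 0 -> ivt_dvd q -> ivt_dvd q^`() -> a < b -> root q a -> root q b ->
  exists c, [/\ a < c, c < b & root q^`() c].
Proof.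
move=> q0 ivt ivt' ab0 ra rb0.
have [rs rsP] := finite_roots q0.
have [|[d + dP]] := seq_min_bound [seq x <- rs | a < x].
  by move=> /(congr1 (fun s => b \in s)); rewrite mem_filter ab0 -rsP rb0.
rewrite mem_filter -rsP => /andP[ad rd].
have db : d <= b by apply: dP; rewrite mem_filter ab0 -rsP.
have noroot c : a < c -> c < d -> ~~ root q c.
  move=> ac cd; apply/negP => rc.
  by have := dP c; rewrite mem_filter ac -rsP rc leNgt cd => /(_ isT).
suff [c [ac cd rc]] : exists c, [/\ a < c, c < d & root q^`() c].
  by exists c; split=> //; exact: lt_le_trans db.
have [i [g1 /implyP/(_ q0) g1a qE]] := multiplicity_XsubC q a.
have g10 : g1 != 0 by apply: contraNneq q0 => g10; rewrite qE g10 mul0r.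
case: i qE => [|i] qE; first by move: ra; rewrite qE mulr1 (negPf g1a).
have rg1d : root g1 d.
  move: rd; rewrite qE rootM => /orP[//|]; rewrite rootE horner_exp hornerXsubC.
  by rewrite expf_eq0 /= subr_eq0 gt_eqF.
have [j [g /implyP/(_ g10) gd g1E]] := multiplicity_XsubC g1 d.
case: j g1E => [|j] g1E; first by move: rg1d; rewrite g1E mulr1 (negPf gd).
have ga : g.[a] != 0.
  by move: g1a; rewrite g1E rootM negb_or => /andP[].
have gd0 : g.[d] != 0 by [].
have gad : 0 < g.[a] * g.[d].
  have [neg|] := ltP (g.[a] * g.[d]) 0.
    have [|c [ac cd rc]] := ivt g _ _ _ ad neg.
      by rewrite qE g1E -mulrA dvdp_mulr.
    by have := noroot c ac cd; rewrite qE g1E !rootM rc.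
  by rewrite le_eqVlt eq_sym mulf_eq0 (negPf ga) (negPf gd0).
(* Here q' = (X - a)^i (X - d)^j h, and at each of a and d only one summand of h survives. *)
pose h := g^`() * ('X - a%:P) * ('X - d%:P) +
  g * (('X - a%:P) *+ j.+1 + ('X - d%:P) *+ i.+1).
have hq' : h %| q^`().
  apply/dvdpP; exists (('X - a%:P) ^+ i * ('X - d%:P) ^+ j).
  rewrite qE g1E !derivM !deriv_exp !derivXsubC !mul1r /h !exprS /=.
  by rewrite -[in LHS]mulr_natr -[in RHS]mulr_natr; ring.
have := ivt' h hq' a d ad.
have ha : h.[a] = g.[a] * (a - d) *+ i.+1.
  rewrite /h !(hornerXsubC, hornerD, hornerM, hornerMn) subrr mulr0 mul0r add0r.
  by rewrite mul0rn add0r mulrnAr.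
have hd : h.[d] = g.[d] * (d - a) *+ j.+1.
  rewrite /h !(hornerXsubC, hornerD, hornerM, hornerMn) subrr mulr0 add0r.
  by rewrite mul0rn addr0 mulrnAr.
have neg : h.[a] * h.[d] < 0.
  rewrite ha hd mulrnAl mulrnAr !pmulrn_llt0 // mulrACA pmulr_rlt0 //.
  by rewrite pmulr_llt0 ?subr_lt0 // subr_gt0.
move=> /(_ neg)[c [ac cd rc]]; exists c; split=> //.
by move/dvdpP: hq' => [k ->]; rewrite rootM rc orbT.
Qed.

Lemma lead_coef_sgz (E : realFieldType) (q : {poly E}) : q != 0 ->
  exists M, forall x, M <= x -> sgz q.[x] = sgz (lead_coef q).
Proof.
move=> q0.
(* A positive lower bound [d], not just the sign, is carried through the Horner induction:
   multiplied by a large x it outweighs the next coefficient. *)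
suff [M [d d0 dP]] : exists M, exists2 d : E, 0 < d &
    forall x, M <= x -> d <= Num.sg (lead_coef q) * q.[x].
  exists M => x /dP h; have : 0 < Num.sg (lead_coef q) * q.[x] by exact: lt_le_trans h.
  by rewrite -sgz_gt0 sgzM sgz_sgr; do 2!case: sgzP.
elim/poly_ind: q q0 => [|p c IHp]; first by rewrite eqxx.
have [->|p0 _] := eqVneq p 0.
  rewrite mul0r add0r => c0; have {}c0 : c != 0 by rewrite polyC_eq0 in c0.
  exists 0, `|c|; first by rewrite normr_gt0.
  by move=> x _; rewrite lead_coefC hornerC -normrEsg.
have [M [d d0 dP]] := IHp p0.
have lcE : lead_coef (p * 'X + c%:P) = lead_coef p.
  rewrite lead_coefDl ?lead_coefMX // size_polyC size_mulX //.
  by rewrite (leq_ltn_trans (leq_b1 _)) // ltnS size_poly_gt0.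
exists (Num.max M (1 + `|c| / d)), d => // x; rewrite ge_max => /andP[Mx cx].
rewrite lcE hornerMXaddC mulrDr mulrA.
have h1 := dP x Mx.
have h2 : - `|c| <= Num.sg (lead_coef p) * c.
  have : `|Num.sg (lead_coef p) * c| <= `|c|.
    by rewrite normrM normr_sg lead_coef_eq0 p0 mul1r.
  by rewrite ler_norml => /andP[].
have x0 : 0 <= x by apply: le_trans cx; rewrite addr_ge0 // divr_ge0 // ltW.
have h3 : d * x <= Num.sg (lead_coef p) * p.[x] * x by exact: ler_wpM2r.
have h4 : d + `|c| <= d * x.
  rewrite -[X in X + _]mulr1 -{1}(divfK (lt0r_neq0 d0) `|c|) [_ / d * d]mulrC.
  by rewrite -mulrDr ler_pM2l.
by lra.
Qed.

(** * Transfer of sign tables *)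

(* Finite lists of pairs encode an order isomorphism between finite subsets of [F1]
   and [F2]; [matched zs x y] says that [x] and [y] lie in corresponding gaps. *)
Definition matched (F1 F2 : realFieldType) (zs : seq (F1 * F2)) x y :=
  forall p, p \in zs -> sgz (x - p.1) = sgz (y - p.2).

Definition consistent (F1 F2 : realFieldType) (zs : seq (F1 * F2)) :=
  forall p, p \in zs -> matched zs p.1 p.2.

Definition flip (T1 T2 : Type) (p : T1 * T2) := (p.2, p.1).

Section Matching.
Variables F1 F2 : realFieldType.
Implicit Types (zs : seq (F1 * F2)).

Lemma mem_flip zs p : (flip p \in map (@flip _ _) zs) = (p \in zs).
Proof. by rewrite mem_map // => -[a b] [c d] [-> ->]. Qed.

Lemma flipK (p : F2 * F1) : flip (flip p) = p. Proof. by case: p. Qed.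

Lemma matched_flip zs x y : matched zs x y -> matched (map (@flip _ _) zs) y x.
Proof. by move=> h p; rewrite -(flipK p) mem_flip => /h. Qed.

Lemma matched_unflip zs x y : matched (map (@flip _ _) zs) y x -> matched zs x y.
Proof. by move=> h p; rewrite -mem_flip => /h. Qed.

Lemma consistent_flip zs : consistent zs -> consistent (map (@flip _ _) zs).
Proof.
by move=> h p; rewrite -(flipK p) mem_flip => /h; exact: matched_flip.
Qed.

Lemma matched_in zs p y : p \in zs -> matched zs p.1 y -> y = p.2.
Proof. 
by move=> pz /(_ p pz); rewrite subrr sgz0 => /esym/eqP; rewrite sgz_eq0 subr_eq0 => /eqP.
Qed.

Lemma matched_sub zs zs' x y : {subset zs <= zs'} -> matched zs' x y -> matched zs x y.
Proof. by move=> s h p /s; exact: h. Qed.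

Lemma consistent_cons zs x y : consistent zs -> matched zs x y ->
  consistent ((x, y) :: zs).
Proof.
move=> cs m p; rewrite inE => /orP[/eqP->|pz] q; rewrite inE => /orP[/eqP->|qz] /=.
- by rewrite !subrr !sgz0.
- exact: m.
- by rewrite -opprB sgzN m // -sgzN opprB.
- exact: cs.
Qed.

Lemma consistent_lt zs p q : consistent zs -> p \in zs -> q \in zs ->
  (p.1 < q.1) = (p.2 < q.2).
Proof.
move=> cs pz qz; have := cs _ pz _ qz => e.
by rewrite -[LHS]subr_lt0 -[RHS]subr_lt0 -[LHS]sgz_lt0 -[RHS]sgz_lt0 e.
Qed.

Lemma consistent_le zs p q : consistent zs -> p \in zs -> q \in zs ->
  (p.1 <= q.1) = (p.2 <= q.2).
Proof. by move=> cs pz qz; rewrite !leNgt (consistent_lt cs qz pz). Qed.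

Lemma lower_neighbor zs (x : F1) :
  (forall p, p \in zs -> x <= p.1) \/
  exists2 u, u \in zs & u.1 < x /\ forall p, p \in zs -> p.1 < x -> p.1 <= u.1.
Proof.
have [h|[m + mP]] := seq_max_bound [seq p.1 | p <- zs & p.1 < x].
  left => p pz; rewrite leNgt; apply/negP => px.
  suff : p.1 \in [::] by [].
  by rewrite -h map_f // mem_filter px.
move=> /mapP[u]; rewrite mem_filter => /andP[ux uz] mE; right; exists u => //.
by split=> // p pz px; rewrite -mE mP // map_f // mem_filter px.
Qed.

Lemma upper_neighbor zs (x : F1) :
  (forall p, p \in zs -> p.1 <= x) \/
  exists2 v, v \in zs & x < v.1 /\ forall p, p \in zs -> x < p.1 -> v.1 <= p.1.
Proof.
have [h|[m + mP]] := seq_min_bound [seq p.1 | p <- zs & x < p.1].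
  left => p pz; rewrite leNgt; apply/negP => px.
  suff : p.1 \in [::] by [].
  by rewrite -h map_f // mem_filter px.
move=> /mapP[u]; rewrite mem_filter => /andP[ux uz] mE; right; exists u => //.
by split=> // p pz px; rewrite -mE mP // map_f // mem_filter px.
Qed.

Lemma matched_between zs x y (u v : F1 * F2) : consistent zs ->
  u \in zs -> v \in zs -> u.1 < x -> x < v.1 -> u.2 < y -> y < v.2 ->
  (forall p, p \in zs -> p.1 < x -> p.1 <= u.1) ->
  (forall p, p \in zs -> x < p.1 -> v.1 <= p.1) ->
  x \notin map fst zs -> matched zs x y.
Proof.
move=> cs uz vz ux xv uy yv uP vP xz p pz.
have [xp|px|xE] := ltgtP x p.1; last by case/negP: xz; rewrite xE map_f.
  rewrite !ltr0_sgz ?subr_lt0 //; apply: lt_le_trans yv _.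
  by rewrite -(consistent_le cs) // vP.
rewrite !gtr0_sgz ?subr_gt0 //; apply: le_lt_trans uy.
by rewrite -(consistent_le cs) // uP.
Qed.

Lemma matched_ex zs x : consistent zs -> exists y, matched zs x y.
Proof.
move=> cs; have [/mapP[p pz ->]|xz] := boolP (x \in map fst zs).
  by exists p.2; exact: cs.
have [y yP] : exists y, forall p, p \in zs ->
    (p.1 < x -> p.2 < y) /\ (x < p.1 -> y < p.2).
  have [lo|[u uz [ux uP]]] := lower_neighbor zs x;
    have [hi|[v vz [xv vP]]] := upper_neighbor zs x.
  - exists 0 => p pz; case/negP: xz.
    by rewrite (_ : x = p.1) ?map_f //; apply/le_anti; rewrite lo // hi.
  - exists (v.2 - 1) => p pz; split; first by rewrite ltNge lo.
    move=> xp; rewrite (lt_le_trans (_ : _ < v.2)) ?ltrBlDr ?ltrDl //.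
    by rewrite -(consistent_le cs) // vP.
  - exists (u.2 + 1) => p pz; split; last by rewrite ltNge hi.
    move=> px; rewrite (le_lt_trans (_ : _ <= u.2)) ?ltrDl //.
    by rewrite -(consistent_le cs) // uP.
  - have uv : u.2 < v.2 by rewrite -(consistent_lt cs) // (lt_trans ux).
    exists ((u.2 + v.2) / 2) => p pz; split=> [px|xp].
      by rewrite (le_lt_trans (_ : _ <= u.2)) ?midf_lt // -(consistent_le cs) // uP.
    by rewrite (lt_le_trans (_ : _ < v.2)) ?midf_lt // -(consistent_le cs) // vP.
exists y => p pz; have [h1 h2] := yP p pz.
have [xp|px|xE] := ltgtP x p.1; last by case/negP: xz; rewrite xE map_f.
  by rewrite !ltr0_sgz ?subr_lt0 // h2.
by rewrite !gtr0_sgz ?subr_gt0 // h1.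
Qed.

(** Let u and v be the neighbours of c in the table. All critical points of q1 are table points, so
    by Rolle c is the only root of q1 in [u, v], and it is simple; hence q1 changes sign there. As
    q2 has the same signs at the partners of u and v, it has a root between them. *)
Lemma add_root zs (q1 : {poly F1}) (q2 : {poly F2}) c :
  q1 != 0 -> ivt_dvd q1 -> ivt_dvd q1^`() -> ivt_dvd q2 -> consistent zs ->
  (forall x, root q1^`() x -> x \in map fst zs) ->
  (forall p, p \in zs -> sgz q1.[p.1] = sgz q2.[p.2]) ->
  root q1 c -> c \notin map fst zs ->
  (exists2 m, m \in zs & m.1 < c) -> (exists2 m, m \in zs & c < m.1) ->
  exists2 d, root q2 d & matched zs c d.
Proof.
move=> q10 ivt1 ivt1' ivt2 cs cov sg rc cz [m mz mc] [m' m'z cm'].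
have [lo|[u uz [uc uP]]] := lower_neighbor zs c; first by rewrite ltNge lo in mc.
have [hi|[v vz [cv vP]]] := upper_neighbor zs c; first by rewrite ltNge hi in cm'.
have nocrit x : u.1 < x -> x < v.1 -> ~~ root q1^`() x.
  move=> ux xv; apply/negP => /cov /mapP[p pz xE]; rewrite xE in ux xv.
  have [pc|cp|pE] := ltgtP p.1 c.
  - by have := uP p pz pc; rewrite leNgt ux.
  - by have := vP p pz cp; rewrite leNgt xv.
  - by case/negP: cz; rewrite -pE map_f.
have uniq x : u.1 <= x -> x <= v.1 -> root q1 x -> x = c.
  move=> ux xv rx; apply/eqP; apply: contraT; rewrite neq_lt => /orP[xc|cx].
    have [d [xd dc rd]] := ivt_rolle q10 ivt1 ivt1' xc rx rc.
    by have := nocrit d (le_lt_trans ux xd) (lt_trans dc cv); rewrite rd.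
  have [d [xd dc rd]] := ivt_rolle q10 ivt1 ivt1' cx rc rx.
  by have := nocrit d (lt_trans uc xd) (lt_le_trans dc xv); rewrite rd.
have uv : u.1 < v.1 by exact: lt_trans cv.
have /factor_theorem[g gE] := rc.
have gc : g.[c] != 0.
  have := nocrit c uc cv; rewrite gE derivM derivXsubC mulr1 rootE.
  by rewrite hornerD hornerM hornerXsubC subrr mulr0 add0r.
have gu : g.[u.1] != 0.
  apply/negP => gu; have := uniq u.1; rewrite lexx ltW // gE rootM /root gu.
  by move=> /(_ isT isT isT) => e; rewrite e ltxx in uc.
have gv : g.[v.1] != 0.
  apply/negP => gv; have := uniq v.1; rewrite lexx ltW // gE rootM /root gv.
  by move=> /(_ isT isT isT) => e; rewrite e ltxx in cv.
have guv : 0 < g.[u.1] * g.[v.1].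
  have [neg|] := ltP (g.[u.1] * g.[v.1]) 0.
    have [|d [ud dv rd]] := ivt1 g _ _ _ uv neg; first by rewrite gE dvdp_mulr.
    have := uniq d; rewrite !ltW // gE rootM rd => /(_ isT isT isT) dc.
    by move: rd; rewrite dc rootE (negPf gc).
  by rewrite le_eqVlt eq_sym mulf_eq0 (negPf gu) (negPf gv).
have quv : q1.[u.1] * q1.[v.1] < 0.
  rewrite gE !hornerM !hornerXsubC mulrACA pmulr_rlt0 //.
  by rewrite pmulr_llt0 ?subr_lt0 // subr_gt0.
have quv2 : q2.[u.2] * q2.[v.2] < 0.
  by rewrite -sgz_lt0 sgzM -!sg // -sgzM sgz_lt0.
have uv2 : u.2 < v.2 by rewrite -(consistent_lt cs).
have [d [ud dv rd]] := ivt2 _ (dvdpp _) _ _ uv2 quv2.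
by exists d => //; apply: (matched_between cs uz vz).
Qed.

End Matching.

Lemma lead_coef_sgzN (E : realFieldType) (q : {poly E}) : q != 0 ->
  exists M, forall x, x <= M -> sgz q.[x] = sgz (lead_coef q) * (-1) ^+ (size q).-1.
Proof.
move=> q0.
have lcE : lead_coef (q \Po - 'X) = lead_coef q * (-1) ^+ (size q).-1.
  by rewrite lead_coef_comp ?size_polyN ?size_polyX // lead_coefN lead_coefX.
have [|M MP] := @lead_coef_sgz _ (q \Po - 'X).
  by rewrite -lead_coef_eq0 lcE mulf_neq0 ?lead_coef_eq0 // signr_eq0.
exists (- M) => x xM; have := MP (- x); rewrite lerNr xM => /(_ isT).
rewrite horner_comp hornerN hornerX opprK => ->; rewrite lcE sgzM sgzX.
by rewrite sgzN1.
Qed.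

(** [zs] may contain points that are no roots, which leaves room for sentinels. The last clause
    concerns arbitrary matched points, so it covers the open gaps as well. *)
Definition sign_table (F1 F2 : realFieldType) (W : seq ({poly F1} * {poly F2}))
    (zs : seq (F1 * F2)) :=
  [/\ consistent zs,
      forall w x, w \in W -> root w.1 x -> x \in map fst zs,
      forall w y, w \in W -> root w.2 y -> y \in map snd zs &
      forall x y, matched zs x y -> forall w, w \in W -> sgz w.1.[x] = sgz w.2.[y]].

Lemma map_fst_flip (T1 T2 : eqType) (s : seq (T1 * T2)) :
  map fst (map (@flip _ _) s) = map snd s.
Proof. by rewrite -map_comp. Qed.

(** * The elimination step for one polynomial *)

Section SignTableStep.
Variables (F1 F2 : realFieldType).
Variables (W0 W : seq ({poly F1} * {poly F2})) (q1 : {poly F1}) (q2 : {poly F2}).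
Hypothesis W0W : {subset W <= W0}.
Hypothesis ivtW : forall w, w \in W -> ivt_dvd w.1 /\ ivt_dvd w.2.
Hypothesis ivt1 : ivt_dvd q1.
Hypothesis ivt2 : ivt_dvd q2.
Hypotheses (q10 : q1 != 0) (q20 : q2 != 0).
Hypothesis qlc : sgz (lead_coef q1) = sgz (lead_coef q2).
Hypothesis qsz : size q1 = size q2.
Hypothesis derW : (q1^`(), q2^`()) \in W.
Hypothesis rootW : forall x y, (forall r, r \in W0 -> sgz r.1.[x] = sgz r.2.[y]) ->
  forall w, w \in W -> root w.1 x -> sgz q1.[x] = sgz q2.[y].

(** While points are being added, the signs of q1 and q2 are compared only at table points; the gaps
    are settled at the end, in [matched_sgz]. *)
Let Inv zs := sign_table W zs /\ forall p, p \in zs -> sgz q1.[p.1] = sgz q2.[p.2].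

Lemma root_sgz (E : realFieldType) (q : {poly E}) x : root q x = (sgz q.[x] == 0).
Proof. by rewrite sgz_eq0. Qed.

(** Only roots of members of [W] are kept: there [rootW] determines the sign of q1. At points that
    are merely roots of remainders this sign is not known. *)
Lemma sign_table_restrict zs : sign_table W0 zs -> exists zs', Inv zs'.
Proof.
move=> [cs cov1 cov2 sg].
pose zs' := [seq p <- zs | has (fun w => root w.1 p.1) W].
have sub : {subset zs' <= zs} by move=> p; rewrite mem_filter => /andP[].
have cs' : consistent zs' by move=> p /sub pz; apply: matched_sub sub (cs _ pz).
have cov1' w x : w \in W -> root w.1 x -> x \in map fst zs'.
  move=> wW rx; have /mapP[p pz xE] := cov1 w x (W0W wW) rx.
  by rewrite xE map_f // mem_filter pz andbT; apply/hasP; exists w => //; rewrite -xE.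
have cov2' w y : w \in W -> root w.2 y -> y \in map snd zs'.
  move=> wW ry; have /mapP[p pz yE] := cov2 w y (W0W wW) ry.
  rewrite yE map_f // mem_filter pz andbT; apply/hasP; exists w => //.
  by rewrite root_sgz (sg _ _ (cs _ pz) _ (W0W wW)) -yE -root_sgz.
exists zs'; split; last first.
  move=> p pz'; have pz := sub p pz'.
  move: pz'; rewrite mem_filter => /andP[/hasP[w wW rw] _].
  by apply: rootW wW rw => r rW0; exact: sg (cs _ pz) _ rW0.
split=> // x y mxy w wW.
(* [y] is matched with x only for the smaller table. [y'] is matched for the full one and lies on
   the same side of every root of [w.2] as [y]. *)
have [y' my'] := matched_ex x cs; rewrite (sg _ _ my' _ (W0W wW)).
apply: ivt_sgz; first by case: (ivtW wW).
move=> c rc; have /mapP[p pz' ->] := cov2' w c wW rc.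
by rewrite -(my' p (sub p pz')) -(mxy p pz').
Qed.

Lemma Inv_cons zs x y : Inv zs -> matched zs x y -> sgz q1.[x] = sgz q2.[y] ->
  Inv ((x, y) :: zs).
Proof.
move=> [[cs cov1 cov2 sg] sq] mxy qxy; split; last first.
  by move=> p; rewrite inE => /orP[/eqP->|/sq].
have sub : {subset zs <= (x, y) :: zs} by move=> p pz; rewrite inE pz orbT.
split.
- exact: consistent_cons.
- by move=> w c wW rc; rewrite inE (cov1 w) ?orbT.
- by move=> w c wW rc; rewrite inE (cov2 w) ?orbT.
- by move=> a b mab; apply: sg; apply: matched_sub sub mab.
Qed.

(** The two sentinels give every root of q1 or q2 table points on both sides, as [add_root]
    demands. *)
Let Ext (zs : seq (F1 * F2)) := exists m M, [/\ m \in zs, M \in zs,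
  forall x, root q1 x -> m.1 < x < M.1 & forall y, root q2 y -> m.2 < y < M.2].

Lemma Ext_sub zs zs' : {subset zs <= zs'} -> Ext zs -> Ext zs'.
Proof. by move=> s [m [M [mz Mz h1 h2]]]; exists m, M; split=> //; exact: s. Qed.

Lemma add_top zs : Inv zs -> exists M, [/\ Inv (M :: zs),
  forall x, root q1 x -> x < M.1 & forall y, root q2 y -> y < M.2].
Proof.
move=> I; have [M1 M1P] := lead_coef_sgz q10; have [M2 M2P] := lead_coef_sgz q20.
have [r1 r1P] := finite_roots q10; have [r2 r2P] := finite_roots q20.
have top (E : realFieldType) (s : seq E) M : exists2 m, M <= m & forall x, x \in s -> x < m.
  have [->|[m ms mP]] := seq_max_bound s; first by exists M.
  exists (Num.max M (m + 1)); first by rewrite le_max lexx.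
  by move=> x /mP xm; rewrite lt_max orbC (le_lt_trans xm) ?ltrDl.
have [a aM aP] := top _ (r1 ++ map fst zs) M1.
have [b bM bP] := top _ (r2 ++ map snd zs) M2.
exists (a, b); split.
- apply: Inv_cons => //; last by rewrite M1P // M2P.
  move=> p pz; rewrite !gtr0_sgz ?subr_gt0 //.
    by apply: bP; rewrite mem_cat map_f ?orbT.
  by apply: aP; rewrite mem_cat map_f ?orbT.
- by move=> x; rewrite r1P => h; apply: aP; rewrite mem_cat h.
- by move=> x; rewrite r2P => h; apply: bP; rewrite mem_cat h.
Qed.

Lemma add_bottom zs : Inv zs -> exists M, [/\ Inv (M :: zs),
  forall x, root q1 x -> M.1 < x & forall y, root q2 y -> M.2 < y].
Proof.
move=> I; have [M1 M1P] := lead_coef_sgzN q10; have [M2 M2P] := lead_coef_sgzN q20.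
have [r1 r1P] := finite_roots q10; have [r2 r2P] := finite_roots q20.
have bot (E : realFieldType) (s : seq E) M : exists2 m, m <= M & forall x, x \in s -> m < x.
  have [->|[m ms mP]] := seq_min_bound s; first by exists M.
  exists (Num.min M (m - 1)); first by rewrite ge_min lexx.
  by move=> x /mP xm; rewrite gt_min orbC (lt_le_trans _ xm) ?ltrBlDr ?ltrDl.
have [a aM aP] := bot _ (r1 ++ map fst zs) M1.
have [b bM bP] := bot _ (r2 ++ map snd zs) M2.
exists (a, b); split.
- apply: Inv_cons => //; last by rewrite M1P // M2P // qlc qsz.
  move=> p pz; rewrite !ltr0_sgz ?subr_lt0 //.
    by apply: bP; rewrite mem_cat map_f ?orbT.
  by apply: aP; rewrite mem_cat map_f ?orbT.
- by move=> x; rewrite r1P => h; apply: aP; rewrite mem_cat h.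
- by move=> x; rewrite r2P => h; apply: bP; rewrite mem_cat h.
Qed.

Lemma add_roots1 zs rs : Inv zs -> Ext zs -> all (root q1) rs ->
  exists zs', [/\ Inv zs', {subset zs <= zs'} & {subset rs <= map fst zs'}].
Proof.
move=> I X; elim: rs => [|c rs IHrs] /=; first by move=> _; exists zs; split.
move=> /andP[rc /IHrs[zs' [I' sub rsub]]].
have [cz|cz] := boolP (c \in map fst zs').
  by exists zs'; split=> // x; rewrite inE => /orP[/eqP->//|/rsub].
have [m [M [mz Mz h1 _]]] := Ext_sub sub X; have /andP[mc cM] := h1 c rc.
case: (I') => -[cs cov1 _ _] sq; have [ivt' _] := ivtW derW.
have [|||d rd md] := add_root q10 ivt1 ivt' ivt2 cs _ sq rc cz.
- by move=> x; exact: cov1 derW.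
- by exists m.
- by exists M.
exists ((c, d) :: zs'); split.
- by apply: Inv_cons => //; move: rc rd; rewrite !root_sgz => /eqP-> /eqP->.
- by move=> p /sub pz; rewrite inE pz orbT.
- by move=> x; rewrite inE => /orP[/eqP->|/rsub h]; rewrite /= inE ?eqxx ?h ?orbT.
Qed.

Lemma add_roots2 zs rs : Inv zs -> Ext zs -> all (root q2) rs ->
  exists zs', [/\ Inv zs', {subset zs <= zs'} & {subset rs <= map snd zs'}].
Proof.
move=> I X; elim: rs => [|c rs IHrs] /=; first by move=> _; exists zs; split.
move=> /andP[rc /IHrs[zs' [I' sub rsub]]].
have [cz|cz] := boolP (c \in map snd zs').
  by exists zs'; split=> // x; rewrite inE => /orP[/eqP->//|/rsub].
have [m [M [mz Mz _ h1]]] := Ext_sub sub X; have /andP[mc cM] := h1 c rc.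
case: (I') => -[cs _ cov2 _] sq; have [_ ivt'] := ivtW derW.
rewrite -map_fst_flip in cz.
have [|p|||d rd md] := add_root q20 ivt2 ivt' ivt1 (consistent_flip cs) _ _ rc cz.
- by move=> x; rewrite map_fst_flip; exact: cov2 derW.
- by rewrite -(flipK p) mem_flip => /sq ->.
- by exists (flip m); rewrite ?mem_flip.
- by exists (flip M); rewrite ?mem_flip.
exists ((d, c) :: zs'); split.
- apply: Inv_cons => //; first exact: matched_unflip.
  by move: rc rd; rewrite !root_sgz => /eqP-> /eqP->.
- by move=> p /sub pz; rewrite inE pz orbT.
- by move=> x; rewrite inE => /orP[/eqP->|/rsub h]; rewrite /= inE ?eqxx ?h ?orbT.
Qed.

(** For x off the table, some table point p, a neighbour of x or a sentinel, lies on the same side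
    of every root of q1; the sign is then transported from x to p, to its partner, to y. Two
    adjacent table points cannot both be roots of q1, since Rolle would put a root of q1', hence a
    table point, between them. *)
Lemma matched_sgz zs x y : Inv zs -> Ext zs ->
  (forall c, root q1 c -> c \in map fst zs) ->
  (forall c, root q2 c -> c \in map snd zs) ->
  matched zs x y -> sgz q1.[x] = sgz q2.[y].
Proof.
move=> [[cs cov1 cov2 sg] sq] [m [M [mz Mz h1 h2]]] r1 r2 mxy.
have [/mapP[p pz xE]|xz] := boolP (x \in map fst zs).
  by rewrite xE (matched_in pz (_ : matched zs p.1 y)) -?xE // xE sq.
have [ivt' _] := ivtW derW.
suff [p pz pP] : exists2 p, p \in zs &
    forall p', p' \in zs -> root q1 p'.1 -> sgz (x - p'.1) = sgz (p.1 - p'.1).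
  transitivity (sgz q1.[p.1]).
    by apply: ivt_sgz => // c rc; have /mapP[p' pz' cE] := r1 c rc; rewrite cE pP -?cE.
  rewrite sq //; apply: ivt_sgz => // c rc; have /mapP[p' pz' cE] := r2 c rc.
  rewrite cE -(mxy p' pz') -(cs p pz p' pz') pP // root_sgz sq // -cE.
  by rewrite -root_sgz.
have [lo|[u uz [ux uP]]] := lower_neighbor zs x.
  exists m => // p pz rp; have /andP[mp _] := h1 _ rp.
  rewrite !ltr0_sgz ?subr_lt0 // lt_neqAle lo // andbT.
  by apply: contraNneq xz => ->; rewrite map_f.
have [hi|[v vz [xv vP]]] := upper_neighbor zs x.
  exists M => // p pz rp; have /andP[_ pM] := h1 _ rp.
  rewrite !gtr0_sgz ?subr_gt0 // lt_neqAle hi // andbT.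
  by apply: contraNneq xz => <-; rewrite map_f.
have xp p : p \in zs -> p.1 != x.
  by move=> pz; apply: contraNneq xz => <-; rewrite map_f.
have [ru|nru] := boolP (root q1 u.1); last first.
  exists u => // p pz rp; have [px|px|pE] := ltgtP p.1 x.
  - rewrite !gtr0_sgz ?subr_gt0 // lt_neqAle uP // andbT.
    by apply: contraNneq nru => <-.
  - by rewrite !ltr0_sgz ?subr_lt0 // (lt_trans ux).
  - by have := xp p pz; rewrite pE eqxx.
have [rv|nrv] := boolP (root q1 v.1); last first.
  exists v => // p pz rp; have [px|px|pE] := ltgtP p.1 x.
  - by rewrite !gtr0_sgz ?subr_gt0 // (lt_trans px).
  - rewrite !ltr0_sgz ?subr_lt0 // lt_neqAle vP // andbT eq_sym.
    by apply: contraNneq nrv => <-.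
  - by have := xp p pz; rewrite pE eqxx.
have [d [ud dv rd]] := ivt_rolle q10 ivt1 ivt' (lt_trans ux xv) ru rv.
have /mapP[p pz dE] := cov1 _ _ derW rd; rewrite dE in ud dv.
have [px|px|pE] := ltgtP p.1 x.
- by have := uP p pz px; rewrite leNgt ud.
- by have := vP p pz px; rewrite leNgt dv.
- by have := xp p pz; rewrite pE eqxx.
Qed.

Lemma sign_table_step zs : sign_table W0 zs ->
  exists zs', sign_table ((q1, q2) :: W) zs'.
Proof.
move=> /sign_table_restrict[zs1 I1].
have [M [I2 M1 M2]] := add_top I1; have [m [I3 m1 m2]] := add_bottom I2.
have X3 : Ext (m :: M :: zs1).
  exists m, M; split; rewrite ?inE ?eqxx ?orbT //.
  - by move=> x rx; rewrite m1 // M1.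
  - by move=> x rx; rewrite m2 // M2.
have [r1 r1P] := finite_roots q10; have [r2 r2P] := finite_roots q20.
have [|zs4 [I4 s4 h4]] := add_roots1 (rs := r1) I3 X3.
  by apply/allP => x; rewrite r1P.
have X4 := Ext_sub s4 X3.
have [|zs5 [I5 s5 h5]] := add_roots2 (rs := r2) I4 X4.
  by apply/allP => x; rewrite r2P.
have X5 := Ext_sub s5 X4.
have c1 c : root q1 c -> c \in map fst zs5.
  by rewrite r1P => /h4 /mapP[p /s5 pz ->]; rewrite map_f.
have c2 c : root q2 c -> c \in map snd zs5 by rewrite r2P => /h5.
exists zs5; case: (I5) => -[cs cov1 cov2 sg] sq; split=> //.
- by move=> w x; rewrite inE => /orP[/eqP->|/cov1]; [exact: c1|exact].
- by move=> w x; rewrite inE => /orP[/eqP->|/cov2]; [exact: c2|exact].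
- move=> x y mxy w; rewrite inE => /orP[/eqP->|]; last exact: sg.
  exact: matched_sgz I5 X5 c1 c2 mxy.
Qed.

End SignTableStep.

Lemma sign_table_sub (F1 F2 : realFieldType) (W W' : seq ({poly F1} * {poly F2})) zs :
  {subset W' <= W} -> sign_table W zs -> sign_table W' zs.
Proof.
move=> sub [cs cov1 cov2 sg]; split=> //.
- by move=> w x /sub; exact: cov1.
- by move=> w x /sub; exact: cov2.
- by move=> x y /sg h w /sub; exact: h.
Qed.

(** * Uniform sign tables over a coefficient ring *)

Section SignTransfer.
Variables (A : idomainType) (E : realFieldType) (psi : {rmorphism A -> E}).
Implicit Types (q : {poly A}) (C : seq A).

(* Specializations that keep the signs recorded for [psi] do not lower the degree of
   a normal polynomial. *)
Definition normal q := psi (lead_coef q) != 0.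

Definition same_signs C (K : realFieldType) (phi : {rmorphism A -> K}) :=
  forall c, c \in C -> sgz (phi c) = sgz (psi c).

(** [D] lists the polynomials that need their roots in the extension of [E], and [C] the
    coefficients whose signs are consulted. Both are fixed before the extension [i] and the
    specialization [phi], so they can be used to choose these. *)
Definition tabulated (Q : seq {poly A}) := exists (D : seq {poly A}) (C : seq A),
  (forall q, q \in D -> normal q) /\
  forall (F : realFieldType) (i : {rmorphism E -> F}) (K : realFieldType)
    (phi : {rmorphism A -> K}),
    order_hom i -> (forall q, q \in D -> ivt_dvd (map_poly (i \o psi) q)) ->
    (forall q : {poly K}, ivt_dvd q) -> same_signs C phi ->
    exists zs, sign_table [seq (map_poly (i \o psi) q, map_poly phi q) | q <- Q] zs.

(** Leading coefficients in the kernel of [psi] are stripped one at a time and recorded in [C]. *)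
Lemma normalize q : exists (q' : {poly A}) (C : seq A),
  [/\ q' = 0 \/ normal q', (size q' <= size q)%N, forall c, c \in C -> psi c = 0 &
   forall (K : nzRingType) (phi : {rmorphism A -> K}),
     (forall c, c \in C -> phi c = 0) -> map_poly phi q = map_poly phi q'].
Proof.
have [m] := ubnP (size q); elim: m => // m IHm in q * => szq.
have [->|q0] := eqVneq q 0; first by exists 0, [::]; split=> //; left.
have [lc0|lc0] := eqVneq (psi (lead_coef q)) 0; last first.
  by exists q, [::]; split=> //; right.
pose f := \poly_(i < (size q).-1) q`_i.
have szf : (size f < size q)%N.
  by rewrite (leq_ltn_trans (size_poly _ _)) // prednK // size_poly_gt0.
have [|q' [C [q'n szq' CP q'P]]] := IHm f; first exact: leq_trans szf _.
exists q', (lead_coef q :: C); split=> //.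
- by rewrite (leq_trans szq') // ltnW.
- by move=> c; rewrite inE => /orP[/eqP->|/CP].
- move=> K phi h; rewrite -q'P; last by move=> c cC; rewrite h // inE cC orbT.
  apply/polyP => i; rewrite !coef_map coef_poly.
  case: ltngtP => // [ltqi|->]; last first.
    transitivity (0 : K); last exact/esym/(rmorph0 phi).
    by apply: (h (lead_coef q)); rewrite inE eqxx.
  by congr (phi _); rewrite nth_default // -(prednK (_ : (0 < size q)%N)) // size_poly_gt0.
Qed.

Lemma same_signs0 C (K : realFieldType) (phi : {rmorphism A -> K}) c :
  same_signs C phi -> c \in C -> psi c = 0 -> phi c = 0.
Proof. by move=> h /h + c0; rewrite c0 sgz0 => /eqP; rewrite sgz_eq0 => /eqP. Qed.

Lemma normal_neq0 q : normal q -> q != 0.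
Proof. by apply: contraTneq => ->; rewrite /normal lead_coef0 rmorph0 eqxx. Qed.

Lemma normal_deriv q : normal q -> (1 < size q)%N -> normal q^`().
Proof.
move=> nq szq; have q0 := normal_neq0 nq.
move: nq szq (lt_size_deriv q0); rewrite /normal !lead_coefE.
case: (size q) => [|[|k]] //= qk _ szq'.
have c0 : psi (q^`()`_k) != 0.
  by rewrite coef_deriv rmorphMn /= -mulr_natr mulf_neq0 ?pnatr_eq0.
suff -> : size q^`() = k.+1 by [].
apply/anti_leq; rewrite -ltnS szq' ltnNge /=; apply/negP => h.
move: c0; rewrite nth_default // (_ : psi _ = 0) ?eqxx //; exact: rmorph0.
Qed.

Lemma normalize_seq (Q : seq {poly A}) : exists (N : seq {poly A}) (C : seq A),
  [/\ forall r, r \in N -> normal r,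
      forall r, r \in N -> exists2 q, q \in Q & (size r <= size q)%N,
      forall c, c \in C -> psi c = 0 &
      forall q, q \in Q -> exists2 r, r = 0 \/ r \in N &
        forall (K : nzRingType) (phi : {rmorphism A -> K}),
          (forall c, c \in C -> phi c = 0) -> map_poly phi q = map_poly phi r].
Proof.
elim: Q => [|q Q [N [C [h1 h2 h3 h4]]]]; first by exists [::], [::].
have [r [C' [rn szr C'0 rP]]] := normalize q.
exists (if r == 0 then N else r :: N), (C' ++ C); split.
- have [r0|r0] := eqVneq r 0; first exact: h1.
  move=> r'; rewrite inE => /orP[/eqP->|/h1//].
  by case: rn => // r00; rewrite r00 eqxx in r0.
- have h2' r' : r' \in N -> exists2 q', q' \in q :: Q & (size r' <= size q')%N.
    by move=> /h2[q' q'Q szr']; exists q' => //; rewrite inE q'Q orbT.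
  case: eqP => _; first exact: h2'.
  move=> r'; rewrite inE => /orP[/eqP->|/h2'//].
  by exists q; rewrite ?inE ?eqxx.
- by move=> c; rewrite mem_cat => /orP[/C'0|/h3].
- move=> q'; rewrite inE => /orP[/eqP->|/h4[r' r'N r'P]]; last first.
    exists r'.
      case: r'N => [->|r'N]; [by left|right].
      by case: eqP => // _; rewrite inE r'N orbT.
    by move=> K phi h; apply: r'P => c cC; apply: h; rewrite mem_cat cC orbT.
  exists r.
    by case: eqP => [|_]; [left|right; rewrite inE eqxx].
  by move=> K phi h; apply: rP => c cC; apply: h; rewrite mem_cat cC.
Qed.

(** At a root of w, pseudo-division equates a power of lc(w) times q with the remainder, so the sign
    of q follows from those of the remainder and of lc(w). Hence the leading coefficients join the
    sign conditions; that of q also fixes its degree and its behaviour at infinity. *)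
Lemma tabulated_cons q (W Rm : seq {poly A}) (CR : seq A) :
  normal q -> (1 < size q)%N -> (forall w, w \in W -> normal w) -> q^`() \in W ->
  (forall c, c \in CR -> psi c = 0) ->
  (forall w, w \in W -> exists2 r, r = 0 \/ r \in Rm &
     forall (K : nzRingType) (phi : {rmorphism A -> K}),
     (forall c, c \in CR -> phi c = 0) -> map_poly phi (q %% w) = map_poly phi r) ->
  tabulated (W ++ Rm) -> tabulated (q :: W).
Proof.
move=> nq szq nW q'W CR0 RmP [D [C [nD DC]]].
exists (q :: W ++ D), (lead_coef q :: map lead_coef W ++ CR ++ C); split.
  by move=> r; rewrite inE mem_cat => /or3P[/eqP->|/nW|/nD].
move=> F i K phi iP ivtD ivtK sg.
have ivtq : ivt_dvd (map_poly (i \o psi) q) by apply: ivtD; rewrite inE eqxx.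
have sgq : sgz (phi (lead_coef q)) = sgz (psi (lead_coef q)).
  by apply: sg; rewrite inE eqxx.
have sgW w : w \in W -> sgz (phi (lead_coef w)) = sgz (psi (lead_coef w)).
  by move=> wW; apply: sg; rewrite inE mem_cat map_f ?orbT.
have sgC : same_signs C phi.
  by move=> c cC; apply: sg; rewrite inE !mem_cat cC !orbT.
have CR1 c : c \in CR -> (i \o psi) c = 0 by move=> /CR0 /= ->; rewrite rmorph0.
have CR2 c : c \in CR -> phi c = 0.
  move=> cC; apply: (same_signs0 sg); last exact: CR0.
  by rewrite inE !mem_cat cC !orbT.
have lc2 r : normal r -> sgz (phi (lead_coef r)) = sgz (psi (lead_coef r)) ->
    phi (lead_coef r) != 0.
  by move=> nr e; rewrite -sgz_eq0 e sgz_eq0.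
have lc1 r : normal r -> (i \o psi) (lead_coef r) != 0 by rewrite /= fmorph_eq0.
have [|zs st] := DC F i K phi iP _ ivtK sgC.
  by move=> r rD; apply: ivtD; rewrite inE mem_cat rD !orbT.
pose mp r := (map_poly (i \o psi) r, map_poly phi r).
have szmap1 : size (map_poly (i \o psi) q) = size q by rewrite size_map_poly_id0 ?lc1.
have szmap2 : size (map_poly phi q) = size q by rewrite size_map_poly_id0 ?lc2.
apply: (sign_table_step (W0 := map mp (W ++ Rm)) (W := map mp W) _ _ _ _ _ _ _ _ _ _ st).
- by move=> _ /mapP[w wW ->]; rewrite map_f // mem_cat wW.
- move=> _ /mapP[w wW ->]; split=> //=.
  by apply: ivtD; rewrite inE mem_cat wW orbT.
- exact: ivtq.
- exact: ivtK.
- by rewrite -size_poly_gt0 szmap1 ltnW.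
- by rewrite -size_poly_gt0 szmap2 ltnW.
- by rewrite !lead_coef_map_id0 ?lc1 ?lc2 ?rmorph0 //= order_hom_sgz.
- by rewrite szmap1 szmap2.
- by rewrite !deriv_map; exact: (map_f mp).
- move=> x y sgR _ /mapP[w wW ->] /= rw.
  have rw2 : root (map_poly phi w) y.
    have := sgR (mp w); rewrite map_f ?mem_cat ?wW // => /(_ isT) /= e.
    by rewrite root_sgz -e -root_sgz.
  have [r rR rP] := RmP w wW.
  have key (L : realFieldType) (h : {rmorphism A -> L}) z : root (map_poly h w) z ->
      h (lead_coef w) ^+ scalp q w * (map_poly h q).[z] = (map_poly h (q %% w)).[z].
    move=> rz; rewrite -rmorphXn -hornerZ -map_polyZ Pdiv.WeakIdomain.divp_eq.
    by rewrite rmorphD rmorphM hornerD hornerM (eqP rz) mulr0 add0r.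
  have k1 := key F (i \o psi) x rw; have k2 := key K phi y rw2.
  have sr : sgz (map_poly (i \o psi) (q %% w)).[x] = sgz (map_poly phi (q %% w)).[y].
    rewrite !rP //; case: rR => [->|rR]; first by rewrite !rmorph0 !horner0 !sgz0.
    by apply: (sgR (mp r)); rewrite map_f // mem_cat rR orbT.
  have lcn : sgz (phi (lead_coef w)) ^+ scalp q w != 0.
    by rewrite expf_neq0 // sgz_eq0 lc2 // ?nW ?sgW.
  apply: (mulfI lcn); transitivity (sgz (map_poly (i \o psi) (q %% w)).[x]).
    by rewrite -k1 sgzM sgzX /= order_hom_sgz // sgW.
  by rewrite sr -k2 sgzM sgzX.
Qed.

Lemma tabulated_sub (Q Q' : seq {poly A}) :
  {subset Q' <= Q} -> tabulated Q -> tabulated Q'.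
Proof.
move=> sub [D [C [nD DC]]]; exists D, C; split=> // F i K phi iP ivtD ivtK sg.
have [zs st] := DC F i K phi iP ivtD ivtK sg; exists zs.
apply: sign_table_sub st => _ /mapP[q /sub qQ ->].
by apply/mapP; exists q.
Qed.

Lemma tabulated_const q (W : seq {poly A}) :
  normal q -> (size q <= 1)%N -> tabulated W -> tabulated (q :: W).
Proof.
move=> nq /size1_polyC qE [D [C [nD DC]]]; exists D, (q`_0 :: C); split=> //.
move=> F i K phi iP ivtD ivtK sg.
have [|zs [cs cov1 cov2 tab]] := DC F i K phi iP ivtD ivtK.
  by move=> c cC; apply: sg; rewrite inE cC orbT.
have q0 : psi q`_0 != 0 by move: nq; rewrite qE /normal lead_coefC coefC.
have sgq : sgz (phi q`_0) = sgz (psi q`_0) by apply: sg; rewrite inE eqxx.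
have p0 : phi q`_0 != 0 by rewrite -sgz_eq0 sgq sgz_eq0.
have E1 : map_poly (i \o psi) q = (i (psi q`_0))%:P by rewrite {1}qE map_polyC.
have E2 : map_poly phi q = (phi q`_0)%:P by rewrite {1}qE map_polyC.
exists zs; rewrite /= E1 E2; split=> //.
- move=> w x; rewrite inE => /orP[/eqP->|/cov1]; last exact.
  by rewrite rootC fmorph_eq0 (negPf q0).
- move=> w x; rewrite inE => /orP[/eqP->|/cov2]; last exact.
  by rewrite rootC (negPf p0).
- move=> x y /tab h w; rewrite inE => /orP[/eqP->|/h//].
  by rewrite !hornerC sgq order_hom_sgz.
Qed.

(* Cohen-Hoermander induction: a polynomial [q] of maximal degree is traded for its
   derivative and the remainders of [q] by the other polynomials. *)
Lemma tabulated_size d (L M : seq {poly A}) :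
  (forall q, q \in L -> normal q /\ (size q <= d.+1)%N) ->
  (forall q, q \in M -> normal q /\ (size q <= d)%N) ->
  tabulated (L ++ M).
Proof.
elim: d L M => [|d IHd] L M.
  elim: L => [|q L IHL] hL hM.
    case: M hM => [|m M] hM.
      exists [::], [::]; split=> [q|F i K phi _ _ _ _]; first by rewrite in_nil.
      exists [::]; split=> [p|w x|w y|x y _ w]; by rewrite in_nil.
    have [/normal_neq0 m0] := hM m (mem_head _ _).
    by rewrite leqn0 size_poly_eq0 (negPf m0).
  have [nq szq] := hL q (mem_head _ _).
  apply: tabulated_const => //; apply: IHL => // r rL.
  by apply: hL; rewrite inE rL orbT.
elim: L M => [|q L IHL] M hL hM; first rewrite -[M]cats0.
  by apply: (IHd M [::]) => // q; rewrite in_nil.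
have hL' r : r \in L -> normal r /\ (size r <= d.+2)%N.
  by move=> rL; apply: hL; rewrite inE rL orbT.
have [nq szq] := hL q (mem_head _ _).
have [sz1|sz1] := leqP (size q) 1.
  by apply: tabulated_const => //; apply: IHL.
have nq' := normal_deriv nq sz1.
have szq' : (size q^`() <= d.+1)%N.
  by rewrite -ltnS (leq_trans (lt_size_deriv (normal_neq0 nq))).
pose W := L ++ q^`() :: M.
have hW w : w \in W -> normal w /\ (size w <= d.+2)%N.
  rewrite mem_cat inE => /or3P[/hL'//|/eqP->|/hM[nw szw]].
    by split=> //; exact: leqW.
  by split=> //; exact: leqW.
have [Rm [C [nR szR C0 RmP]]] := normalize_seq [seq q %% w | w <- W].
apply: (@tabulated_sub (q :: W)).
  move=> r; rewrite !(inE, mem_cat) => /or3P[->//|->|->]; by rewrite ?orbT.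
apply: (tabulated_cons nq sz1 _ _ C0 (fun w wW => RmP _ (map_f _ wW))).
- by move=> w /hW[].
- by rewrite mem_cat inE eqxx orbT.
(* [q] has left the first list; its derivative and the remainders have size at most [d.+1] and join
   the second one. *)
rewrite -catA; apply: IHL => // r; rewrite /= inE mem_cat => /or3P[/eqP->//|/hM//|rR].
split; first exact: nR.
have [_ /mapP[w wW ->] szr] := szR r rR; have [nw szw] := hW w wW.
rewrite (leq_trans szr) // -ltnS (leq_trans _ szw) //.
by rewrite Pdiv.CommonIdomain.ltn_modpN0 // normal_neq0.
Qed.

Lemma tabulated_normal (Q : seq {poly A}) :
  (forall q, q \in Q -> normal q) -> tabulated Q.
Proof.
move=> nQ; rewrite -[Q]cats0.
apply: (@tabulated_size (\max_(q <- Q) size q)%N) => q qQ; last by rewrite in_nil in qQ.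
split; first exact: nQ.
by apply: leqW; apply: (leq_bigmax_seq (F := fun q : {poly A} => size q) q).
Qed.

(** The image of ['X] need not have a counterpart in [K], but any [y] in the matching cell of the
    sign table has the same signs. *)
Lemma poly_point_transfer (psi1 : {rmorphism {poly A} -> E}) (Q : seq {poly A}) :
  (forall a, psi1 a%:P = psi a) ->
  exists C : seq A, forall (K : realFieldType) (phi : {rmorphism A -> K}),
    (forall q : {poly K}, ivt_dvd q) -> same_signs C phi ->
    exists y, forall q, q \in Q -> sgz (map_poly phi q).[y] = sgz (psi1 q).
Proof.
move=> psi1P.
have evE (F : realFieldType) (i : {rmorphism E -> F}) q :
    (map_poly (i \o psi) q).[i (psi1 'X)] = i (psi1 q).
  rewrite -(rmorph_poly_horner psi1 q) -horner_map /= -map_poly_comp /=.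
  by congr horner; apply: eq_map_poly => a /=; rewrite psi1P.
have [N [CN [nN _ CN0 NP]]] := normalize_seq Q.
have [D [C [nD DC]]] := tabulated_normal nN.
exists (CN ++ C) => K phi ivtK sg.
(* Saturating the product serves all of [D] at once, since saturation passes to divisors. *)
pose P := \prod_(q <- D) map_poly psi q.
have P0 : P != 0.
  rewrite prodf_seq_neq0; apply/allP => q qD /=.
  by rewrite -lead_coef_eq0 lead_coef_map_id0 ?rmorph0 //; exact: nD.
have [F [i [iP satP]]] := saturated_ext P0.
have [||zs [cs _ _ tab]] := DC F i K phi iP _ ivtK.
- move=> q qD; apply: saturated_ivt; apply: saturated_dvdp satP.
  rewrite map_poly_comp dvdp_map /P (big_rem q) //=; exact: dvdp_mulr.
- by move=> c cC; apply: sg; rewrite mem_cat cC orbT.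
have [y my] := matched_ex (i (psi1 'X)) cs; exists y => q /NP[r rN rP].
have CN2 c : c \in CN -> phi c = 0.
  by move=> cC; apply: (same_signs0 sg); rewrite ?mem_cat ?cC //; exact: CN0.
have CN1 c : c \in CN -> (i \o psi) c = 0 by move=> /CN0 /= ->; rewrite rmorph0.
rewrite -(order_hom_sgz iP (psi1 q)) -evE !rP //.
case: rN => [->|rN]; first by rewrite !rmorph0 !horner0 !sgz0.
have := tab _ _ my (map_poly (i \o psi) r, map_poly phi r).
by rewrite (map_f (fun q => (map_poly (i \o psi) q, map_poly phi q))) // => /(_ isT).
Qed.
End SignTransfer.

(** * The Artin-Lang theorem and the Positivstellensatz *)

Lemma rcf_ivt_dvd (K : rcfType) (q : {poly K}) : ivt_dvd q.
Proof.
move=> f _ a b ab fab; have [c] := poly_ivtoo (ltW ab) fab.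
by rewrite in_itv /= => /andP[ac cb] rc; exists c.
Qed.

Lemma rcf_order_hom (K : rcfType) (E : realFieldType) (f : {rmorphism K -> E}) :
  order_hom f.
Proof. by move=> x x0; rewrite -(sqr_sqrtr x0) rmorphXn sqr_ge0. Qed.

(** * Polynomials in n variables and specialization at real points *)

Section MPoly.
Variable K : rcfType.

(** The outermost variable is [Fin.F1] and the others live in the coefficient ring, so each
    induction step on n is a univariate statement over [mpol n]. *)
Fixpoint mpol (n : nat) : idomainType :=
  if n is m.+1 then {poly (mpol m)} else K.

Definition vec (n : nat) := Fin.t n -> K.

Definition vec_tail n (x : vec n.+1) : vec n := fun i => x (Fin.FS i).

Definition vec_cons n (a : K) (x : vec n) : vec n.+1 :=
  fun i => Fin.caseS' i (fun _ => K) a x.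

Fixpoint mcst n : {rmorphism K -> mpol n} :=
  match n return {rmorphism K -> mpol n} with
  | 0 => idfun
  | m.+1 => (polyC : {rmorphism mpol m -> {poly mpol m}}) \o mcst m
  end.

Fixpoint mvar n (i : Fin.t n) : mpol n :=
  match i in Fin.t n return mpol n with
  | Fin.F1 m => 'X : {poly (mpol m)}
  | Fin.FS m j => (mvar j)%:P
  end.

Fixpoint mev n : vec n -> {rmorphism mpol n -> K} :=
  match n return vec n -> {rmorphism mpol n -> K} with
  | 0 => fun _ => idfun
  | m.+1 => fun x => (horner_eval (x Fin.F1) : {rmorphism {poly K} -> K})
             \o (map_poly (mev (vec_tail x)) : {rmorphism {poly mpol m} -> {poly K}})
  end.

Fixpoint sqnorm n : mpol n :=
  match n return mpol n with
  | 0 => 0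
  | m.+1 => 'X ^+ 2 + (sqnorm m)%:P
  end.

Lemma mevS n (x : vec n.+1) (q : {poly (mpol n)}) :
  mev x (q : mpol n.+1) = (map_poly (mev (vec_tail x)) q).[x Fin.F1].
Proof. by []. Qed.

Lemma mevC n (x : vec n.+1) (c : mpol n) :
  mev x (c%:P : mpol n.+1) = mev (vec_tail x) c.
Proof. by rewrite mevS map_polyC hornerC. Qed.

Lemma mev_cons n a (x : vec n) (q : {poly (mpol n)}) :
  mev (vec_cons a x) (q : mpol n.+1) = (map_poly (mev x) q).[a].
Proof. by []. Qed.

Lemma mev_mcst n (x : vec n) c : mev x (mcst n c) = c.
Proof. by elim: n x => [|n IHn] x //; rewrite [mcst _ _]/= mevC IHn. Qed.

Lemma mev_mvar n (x : vec n) i : mev x (mvar i) = x i.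
Proof.
elim: i x => [m|m j IHj] x; last by rewrite [mvar _]/= mevC IHj.
by rewrite mevS map_polyX hornerX.
Qed.

Lemma mpol_ind n (H : mpol n -> Prop) :
  (forall c, H (mcst n c)) -> (forall i, H (mvar i)) ->
  (forall f g, H f -> H g -> H (f + g)) -> (forall f g, H f -> H g -> H (f * g)) ->
  forall f, H f.
Proof.
elim: n H => [|n IHn] H Hc Hv HD HM f; first exact: Hc f.
have HC (c : mpol n) : H c%:P.
  apply: (IHn (fun c => H c%:P)) => {c} [c|i|g h Hg Hh|g h Hg Hh].
  - exact: Hc c.
  - exact: Hv (Fin.FS i).
  - by rewrite rmorphD; exact: HD.
  - by rewrite rmorphM; exact: HM.
elim/poly_ind: f => [|p c IHp]; first by rewrite -polyC0; exact: HC.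
by apply: HD => //; apply: HM => //; exact: Hv Fin.F1.
Qed.

Lemma artin_lang n (E : realFieldType) (psi : {rmorphism mpol n -> E})
    (C : seq (mpol n)) : exists z, same_signs psi C (mev z).
Proof.
elim: n E psi C => [|n IHn] E psi C.
  exists (fun=> 0) => c _ /=; apply/esym/order_hom_sgz; exact: rcf_order_hom.
pose psi0 : {rmorphism mpol n -> E} := psi \o (polyC : {rmorphism mpol n -> {poly mpol n}}).
have [C0 C0P] := @poly_point_transfer _ _ psi0 psi C (fun _ => erefl).
have [z0 z0P] := IHn E psi0 C0.
have [y yP] := C0P K (mev z0) (@rcf_ivt_dvd K) z0P.
by exists (vec_cons y z0) => c /yP; rewrite mev_cons.
Qed.

(* Plays the role of Hilbert's basis theorem: finitely many sign conditions force a
   point to annihilate the whole kernel. *)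
Lemma kernel_certificate n (E : realFieldType) (psi : {rmorphism mpol n -> E}) :
  exists C, forall z, same_signs psi C (mev z) ->
    forall m, psi m = 0 -> mev z m = 0.
Proof.
elim: n E psi => [|n IHn] E psi.
  by exists [::] => z _ m /eqP; rewrite fmorph_eq0 => /eqP.
pose psi0 : {rmorphism mpol n -> E} := psi \o (polyC : {rmorphism mpol n -> {poly mpol n}}).
have [C0 C0P] := IHn E psi0.
have psiE (q : {poly mpol n}) : psi q = (map_poly psi0 q).[psi 'X].
  by rewrite -(rmorph_poly_horner psi q).
have same0 (C : seq (mpol n)) (z : vec n.+1) :
    same_signs psi (map polyC C) (mev z) -> same_signs psi0 C (mev (vec_tail z)).
  by move=> h c cC; rewrite -mevC h // map_f.
(* If the kernel has no normal element, each of its elements normalizes to 0, so its coefficients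
   are already killed by [psi0]. *)
have [[g0 [g00 ng0]]|noG] := pselect (exists g, psi g = 0 /\ normal psi0 g); last first.
  exists (map polyC C0) => z /same0/C0P h m; rewrite psiE mevS.
  have [r [C' [rn _ C'0 rP]]] := normalize psi0 m.
  rewrite (rP _ psi0 C'0) (rP _ (mev (vec_tail z))) => [r0|c /C'0]; last exact: h.
  case: rn => [->|nr]; first by rewrite rmorph0 horner0.
  by case: noG; exists r; split=> //; rewrite psiE.
(* Pseudo-division by a normal kernel element of least degree leaves a remainder whose coefficients
   [psi0] kills; the recorded sign of lc(g) allows its power to be cancelled at z. *)
have [g [g1 ng gmin]] : exists g, [/\ psi g = 0, normal psi0 g &
    forall h, psi h = 0 -> normal psi0 h -> (size g <= size h)%N].
  have [m] := ubnP (size g0); elim: m => // m IHm in g0 g00 ng0 * => szg.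
  have [[h [h0 nh szh]]|nh] := pselect (exists h,
      [/\ psi h = 0, normal psi0 h & (size h < size g0)%N]).
    by apply: (IHm h h0 nh); exact: leq_trans szh szg.
  exists g0; split=> // h h0 nrh; rewrite leqNgt; apply/negP => szh.
  by case: nh; exists h.
exists ((g : mpol n.+1) :: map polyC (lead_coef g :: C0)) => z sg m m0.
have sgl : same_signs psi0 (lead_coef g :: C0) (mev (vec_tail z)).
  by apply: same0 => c cC; apply: sg; rewrite inE cC orbT.
have kill : forall c, psi0 c = 0 -> mev (vec_tail z) c = 0.
  by apply: C0P => c cC; apply: sgl; rewrite inE cC orbT.
have lc0 : mev (vec_tail z) (lead_coef g) != 0.
  by rewrite -sgz_eq0 sgl ?inE ?eqxx // sgz_eq0.
have gz : mev z g = 0 by apply: (same_signs0 sg) => //; rewrite inE eqxx.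
have dE := Pdiv.WeakIdomain.divp_eq m g.
have rem0 : psi (m %% g) = 0.
  have := congr1 psi dE; rewrite -mul_polyC rmorphD !rmorphM m0 g1 !mulr0 add0r.
  by move=> <-.
have remz : mev z (m %% g) = 0.
  have [r [C' [rn szr C'0 rP]]] := normalize psi0 (m %% g).
  rewrite mevS (rP _ (mev (vec_tail z))) => [|c /C'0]; last exact: kill.
  case: rn => [->|nr]; first by rewrite rmorph0 horner0.
  have r0 : psi r = 0 by rewrite psiE -(rP _ psi0 C'0) -psiE.
  have := gmin r r0 nr; rewrite leqNgt (leq_ltn_trans szr) //.
  by rewrite Pdiv.CommonIdomain.ltn_modpN0 // (normal_neq0 ng).
have := congr1 (mev z) dE; rewrite -mul_polyC rmorphD !rmorphM gz remz mulr0 addr0.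
move=> /eqP; rewrite mulf_eq0 => /orP[|/eqP//].
by rewrite mevC rmorphXn expf_eq0 (negPf lc0) andbF.
Qed.

Lemma positivstellensatz n (T J : mpol n -> Prop) f :
  preorder T -> (forall m, J m -> T m /\ T (- m)) ->
  (forall z, (forall m, J m -> mev z m = 0) -> 0 < mev z f) ->
  exists s t, [/\ T s, T t & t * f = 1 + s].
Proof.
move=> Tp JT fpos; apply: contrapT => nex.
have Tp' := preorder_adjoin (- f) Tp.
have [|E [pi piP]] := preorder_field Tp'.
  move=> [s [t [Ts Tt e]]]; apply: nex; exists s, t; split=> //.
  by rewrite -[t * f]opprK -mulrN -[LHS]add0r -{1}(subrr s) -addrA -opprD -e; ring.
(* Elements of [J] and their negatives lie in [T], so [pi] kills all of [J]; the finite list [C]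
   makes the point do the same. *)
have [C CP] := kernel_certificate pi.
have [z zP] := artin_lang pi (f :: C).
have kz := CP z (fun c cC => zP c (mem_behead (s := f :: C) cC)).
have Jz m : J m -> mev z m = 0.
  move=> /JT[Tm TNm]; apply: kz; apply/eqP.
  by rewrite eq_le -oppr_ge0 -rmorphN !piP //; exact: preorder_adjoin_sub.
have := fpos z Jz; rewrite -sgz_gt0 zP ?mem_head // sgz_gt0 ltNge => /negP; apply.
by rewrite -oppr_ge0 -rmorphN; apply: piP; exact: preorder_adjoin_gen.
Qed.
End MPoly.

(** * Archimedean preorders *)

Lemma preorder_preim (B B' : comNzRingType) (f : {rmorphism B -> B'}) (T : B' -> Prop) :
  preorder T -> preorder (fun x => T (f x)).
Proof.
move=> Tp; split=> [x y Tx Ty|x y Tx Ty|x].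
- by rewrite rmorphD; exact: (preorderD Tp).
- by rewrite rmorphM; exact: (preorderM Tp).
- by rewrite rmorphXn; exact: (preorder_sqr Tp).
Qed.

Lemma sqnorm_subr_sqr (K : rcfType) n (T : mpol K n -> Prop) : preorder T ->
  T (sqnorm K n) /\ forall i, T (sqnorm K n - mvar K i ^+ 2).
Proof.
elim: n T => [|n IHn] T Tp; first by split; [exact: preorder0 Tp|move=> i; inversion i].
have [IH0 IHi] := IHn _
  (preorder_preim (polyC : {rmorphism mpol K n -> {poly mpol K n}}) Tp).
split; first by apply: (preorderD Tp) => //; exact: (preorder_sqr Tp).
move=> i; apply: (Fin.caseS' i (fun i => T (sqnorm K n.+1 - mvar K i ^+ 2))) => [|j] /=.
  by rewrite addrAC subrr add0r.
rewrite -addrA; apply: (preorderD Tp); first exact: (preorder_sqr Tp).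
by rewrite -rmorphXn -rmorphB; exact: IHi.
Qed.

Section Archimedean.
Variables (K : realType) (n : nat).
Local Notation c := (mcst K n).
Local Notation q := (sqnorm K n).
Implicit Types (T : mpol K n -> Prop) (a b f : mpol K n).

Lemma preorder_mcst T r : preorder T -> 0 <= r -> T (c r).
Proof.
by move=> Tp r0; rewrite -(sqr_sqrtr r0) rmorphXn; exact: (preorder_sqr Tp).
Qed.

(** These elements form a subring, so a bound on the coordinates spreads to all polynomials. *)
Definition bounded_mod T a := exists N, T (c N - a) /\ T (c N + a).

Section BoundedElements.
Variable T : mpol K n -> Prop.
Hypothesis Tp : preorder T.

Lemma bounded_pos a : bounded_mod T a ->
  exists N, [/\ 0 < N, T (c N - a) & T (c N + a)].
Proof.
move=> [N [h1 h2]]; exists (`|N| + 1).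
have s : c (`|N| + 1) = c N + c (`|N| + 1 - N) by rewrite -rmorphD [N + _]addrC subrK.
have Ts : T (c (`|N| + 1 - N)).
  apply: preorder_mcst => //; rewrite subr_ge0.
  by rewrite (le_trans (ler_norm N)) // lerDl.
split; first by rewrite ltr_wpDl.
- by rewrite s addrAC; exact: (preorderD Tp).
- by rewrite s addrAC; exact: (preorderD Tp).
Qed.

Lemma bounded_mcst r : bounded_mod T (c r).
Proof.
exists `|r|; rewrite -rmorphB -rmorphD; split; apply: preorder_mcst => //.
  by rewrite subr_ge0 ler_norm.
by rewrite -lerBlDr sub0r ler_normr lexx orbT.
Qed.

Lemma bounded_add a b : bounded_mod T a -> bounded_mod T b -> bounded_mod T (a + b).
Proof.
move=> [N [h1 h2]] [M [k1 k2]]; exists (N + M); rewrite rmorphD.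
by split; [rewrite opprD|]; rewrite addrACA; exact: (preorderD Tp).
Qed.

Lemma bounded_opp a : bounded_mod T a -> bounded_mod T (- a).
Proof. by move=> [N [h1 h2]]; exists N; rewrite opprK. Qed.

Lemma bounded_scale r a : 0 <= r -> bounded_mod T a -> bounded_mod T (c r * a).
Proof.
move=> r0 [N [h1 h2]]; exists (r * N); rewrite rmorphM -mulrBr -mulrDr.
by split; apply: (preorderM Tp) => //; exact: preorder_mcst.
Qed.

Lemma bounded_sqr a : bounded_mod T a -> bounded_mod T (a ^+ 2).
Proof.
move=> /bounded_pos[N [N0 h1 h2]]; exists (N ^+ 2); split; last first.
  rewrite rmorphXn; apply: (preorderD Tp); exact: (preorder_sqr Tp).
have e : c (N *+ 2)^-1 * (c N *+ 2) = 1.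
  by rewrite -rmorphMn -rmorphM mulVf ?rmorph1 // mulrn_eq0 /= gt_eqF.
(* The factor 2 N = (N - a) + (N + a) is divided out, hence the positive N from [bounded_pos]. *)
have -> : c (N ^+ 2) - a ^+ 2 = c (N *+ 2)^-1 *
    ((c N - a) ^+ 2 * (c N + a) + (c N + a) ^+ 2 * (c N - a)).
  transitivity ((c (N *+ 2)^-1 * (c N *+ 2)) * (c N ^+ 2 - a ^+ 2)); last by ring.
  by rewrite e mul1r rmorphXn.
apply: (preorderM Tp).
  by apply: preorder_mcst => //; rewrite invr_ge0 mulrn_wge0 // ltW.
by apply: (preorderD Tp); apply: (preorderM Tp) => //; exact: (preorder_sqr Tp).
Qed.

Lemma bounded_mul a b : bounded_mod T a -> bounded_mod T b -> bounded_mod T (a * b).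
Proof.
move=> ha hb.
have e : c 4^-1 * 4 = 1.
  by rewrite -(rmorph_nat c 4) -rmorphM mulVf ?rmorph1 // pnatr_eq0.
have -> : a * b = c 4^-1 * ((a + b) ^+ 2 + - (a - b) ^+ 2).
  transitivity ((c 4^-1 * 4) * (a * b)); last by ring.
  by rewrite e mul1r.
apply: bounded_scale; first by rewrite invr_ge0.
apply: bounded_add; first by apply: bounded_sqr; exact: bounded_add.
by apply: bounded_opp; apply: bounded_sqr; apply: bounded_add => //; exact: bounded_opp.
Qed.

Lemma bounded_all : (exists N, T (c N - q)) -> forall a, bounded_mod T a.
Proof.
move=> [N TN]; apply: mpol_ind; [exact: bounded_mcst| |exact: bounded_add|exact: bounded_mul].
move=> i; have [_ /(_ i) Ti] := sqnorm_subr_sqr Tp.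
have T2 : T (c N - mvar K i ^+ 2).
  by rewrite -(subrK q (c N)) -addrA; exact: (preorderD Tp).
have e : c 2^-1 * 2 = 1.
  by rewrite -(rmorph_nat c 2) -rmorphM mulVf ?rmorph1 // pnatr_eq0.
have e2 : c 4^-1 = c 2^-1 ^+ 2.
  by rewrite -rmorphXn; congr (c _); lra.
(* The constant 1/4 completes the square in N - x_i^2 plus (x_i - 1/2)^2 or (x_i + 1/2)^2. *)
exists (N + 4^-1); rewrite rmorphD e2; split.
  have -> : c N + c 2^-1 ^+ 2 - mvar K i =
      (c N - mvar K i ^+ 2) + (mvar K i - c 2^-1) ^+ 2.
    transitivity (c N + c 2^-1 ^+ 2 - (c 2^-1 * 2) * mvar K i); last by ring.
    by rewrite e mul1r.
  by apply: (preorderD Tp) => //; exact: (preorder_sqr Tp).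
have -> : c N + c 2^-1 ^+ 2 + mvar K i =
    (c N - mvar K i ^+ 2) + (mvar K i + c 2^-1) ^+ 2.
  transitivity (c N + c 2^-1 ^+ 2 + (c 2^-1 * 2) * mvar K i); last by ring.
  by rewrite e mul1r.
by apply: (preorderD Tp) => //; exact: (preorder_sqr Tp).
Qed.

End BoundedElements.

(* Woermann's trick: [t] is bounded modulo [T + T (N - q)], and multiplying the
   bound by [1 + t] brings it back into [T]. *)
Lemma bounded_all_of_certificate T N s t : preorder T -> 0 <= N ->
  T s -> T t -> s * (c N - q) = 1 + t -> forall a, bounded_mod T a.
Proof.
move=> Tp N0 Ts Tt; set p := c N - q => spE.
have T1t : T (1 + t) by apply: (preorderD Tp) => //; exact: preorder1 Tp.
(* By the certificate, (1 + t) p = s p^2. *)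
have Tsp : T ((1 + t) * p).
  by rewrite -spE -mulrA -expr2; apply: (preorderM Tp) => //; exact: (preorder_sqr Tp).
have T0q : exists N', exists s t, [/\ T s, T t & c N' - q = s + t * p].
  by exists N; exact: preorder_adjoin_gen.
have [M [[t1 [t2 [Tt1 Tt2 ME]]] _]] := bounded_all (preorder_adjoin p Tp) T0q t.
have TM : T ((1 + t) * (c M - t)).
  rewrite ME mulrDr; apply: (preorderD Tp); first exact: (preorderM Tp).
  by rewrite mulrCA; exact: (preorderM Tp).
have e : c 2^-1 * 2 = 1.
  by rewrite -(rmorph_nat c 2) -rmorphM mulVf ?rmorph1 // pnatr_eq0.
(* The term M^2 / 4 completes the square: L - t = (1 + t)(M - t) + (t - M / 2)^2. *)
pose L := M + (M * 2^-1) ^+ 2.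
have TL : T (c L - t).
  have -> : c L - t = (1 + t) * (c M - t) + (t - c M * c 2^-1) ^+ 2.
    rewrite /L rmorphD rmorphXn rmorphM.
    transitivity (c M + (c M * c 2^-1) ^+ 2 - t + c M * t - (c 2^-1 * 2) * c M * t);
      last by ring.
    by rewrite e; ring.
  by apply: (preorderD Tp) => //; exact: (preorder_sqr Tp).
apply: bounded_all => //; exists (N + N * L).
have -> : c (N + N * L) - q = (1 + t) * p + t * q + c N * (c L - t).
  by rewrite /p rmorphD rmorphM; ring.
have [Tq _] := sqnorm_subr_sqr Tp.
apply: (preorderD Tp); last by apply: (preorderM Tp) => //; exact: preorder_mcst.
by apply: (preorderD Tp) => //; exact: (preorderM Tp).
Qed.

(* The descent [r -> r - 1/N] rests on
   [(N - t) (f + r) + (t f - 1) + r t = N (f + r - 1/N)]. *)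
Lemma archimedean_mem T f s t : preorder T -> (forall a, bounded_mod T a) ->
  T s -> T t -> t * f = 1 + s -> T f.
Proof.
move=> Tp Tb Ts Tt tfE.
have [N [N0 TNt _]] := bounded_pos Tp (Tb t); have [r0 [_ Tr0]] := Tb f.
suff H k : forall r, r <= k%:R / N -> T (c r + f) -> T f.
  apply: (H (Num.truncn (r0 * N)).+1) Tr0.
  by rewrite ler_pdivlMr // ltW // truncnS_gt.
have base r : r <= 0 -> T (c r + f) -> T f.
  move=> r_le0 Tr; have -> : f = c r + f + c (- r) by rewrite rmorphN; ring.
  by apply: (preorderD Tp) => //; apply: preorder_mcst => //; rewrite oppr_ge0.
elim: k => [|k IHk] r rk Tr; first by apply: base Tr; rewrite mul0r in rk.
have [r0'|r_gt0] := leP r 0; first exact: base Tr.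
apply: (IHk (r - N^-1)); first by move: rk; rewrite -addn1 natrD mulrDl mul1r lerBlDr.
have e : c N^-1 * c N = 1 by rewrite -rmorphM mulVf ?rmorph1 // gt_eqF.
have -> : c (r - N^-1) + f = c N^-1 * ((c N - t) * (c r + f) + s + c r * t).
  have -> : s = t * f - 1 by rewrite tfE; ring.
  transitivity ((c N^-1 * c N) * (c r + f) - c N^-1); last by ring.
  by rewrite e rmorphB; ring.
apply: (preorderM Tp); first by apply: preorder_mcst => //; rewrite invr_ge0 ltW.
apply: (preorderD Tp); last by apply: (preorderM Tp) => //; apply: preorder_mcst => //; exact: ltW.
by apply: (preorderD Tp) => //; exact: (preorderM Tp).
Qed.
End Archimedean.

(** * Polynomial functions and sums of squares modulo an ideal *)

Local Notation rvec := (vec R).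
Local Notation rpoly := (mpol R).

Lemma polyk_le n k k' f : polyk n k f -> (k <= k')%N -> polyk n k' f.
Proof.
move=> h; elim: h k' => [j c|j i j1|j f1 g1 _ IHf _ IHg|j a b f1 g1 hf _ hg _ ab] k' le.
- exact: polyk_const.
- by apply: polyk_var; lia.
- by apply: polyk_add; [exact: IHf|exact: IHg].
- by apply: polyk_mul hf hg _; lia.
Qed.

Lemma is_poly_mev n (m : rpoly n) : is_poly n (fun x => mev x m).
Proof.
apply: (@mpol_ind _ n (fun m => is_poly n (fun x => mev x m))) => {m} [c|i|f g|f g].
- exists 0%N; rewrite (_ : (fun _ => _) = (fun=> c)); first exact: polyk_const.
  by apply/funext => x; rewrite mev_mcst.
- exists 1%N; rewrite (_ : (fun _ => _) = (fun x : point n => x i)).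
    exact: polyk_var.
  by apply/funext => x; rewrite mev_mvar.
- move=> [a fa] [b gb]; exists (maxn a b).
  rewrite (_ : (fun _ => _) = (fun x : point n => Rplus (mev x f) (mev x g))).
    apply: polyk_add; [exact: polyk_le fa (leq_maxl _ _)|exact: polyk_le gb (leq_maxr _ _)].
  by apply/funext => x; rewrite rmorphD.
- move=> [a fa] [b gb]; exists (a + b)%N.
  rewrite (_ : (fun _ => _) = (fun x : point n => Rmult (mev x f) (mev x g))).
    by apply: polyk_mul fa gb _; lia.
  by apply/funext => x; rewrite rmorphM.
Qed.

Lemma polyk_mpol n k f : polyk n k f -> exists m : rpoly n, f = (fun x => mev x m).
Proof.
elim=> {k f} [_ c|_ i _|_ f g _ [m ->] _ [m' ->]|_ a b f g _ [m ->] _ [m' ->] _].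
- by exists (mcst _ n c); apply/funext => x; rewrite mev_mcst.
- by exists (mvar _ i); apply/funext => x; rewrite mev_mvar.
- by exists (m + m'); apply/funext => x; rewrite rmorphD.
- by exists (m * m'); apply/funext => x; rewrite rmorphM.
Qed.

(** * The Euclidean inner product *)

Fixpoint dot n : rvec n -> rvec n -> R :=
  match n return rvec n -> rvec n -> R with
  | 0 => fun _ _ => 0
  | m.+1 => fun x y => x Fin.F1 * y Fin.F1 + dot (vec_tail x) (vec_tail y)
  end.

Section Dot.
Variable n : nat.
Implicit Types x y z : rvec n.

Lemma dotDl x y z : dot (fun i => x i + y i) z = dot x z + dot y z.
Proof.
elim: n x y z => [|m IHm] x y z /=; first by rewrite addr0.
by rewrite (IHm (vec_tail x) (vec_tail y)); ring.
Qed.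

Lemma dotZl a x y : dot (fun i => a * x i) y = a * dot x y.
Proof.
elim: n x y => [|m IHm] x y /=; first by rewrite mulr0.
by rewrite (IHm (vec_tail x)); ring.
Qed.

Lemma dotC x y : dot x y = dot y x.
Proof. by elim: n x y => [|m IHm] x y //=; rewrite IHm mulrC. Qed.

Lemma dotBl x y z : dot (fun i => x i - y i) z = dot x z - dot y z.
Proof.
have -> : (fun i => x i - y i) = (fun i => x i + (-1) * y i).
  by apply/funext => i; rewrite mulN1r.
by rewrite dotDl dotZl mulN1r.
Qed.

Lemma dotDr x y z : dot z (fun i => x i + y i) = dot z x + dot z y.
Proof. by rewrite !(dotC z) dotDl. Qed.
Lemma dotZr a x y : dot y (fun i => a * x i) = a * dot y x.
Proof. by rewrite !(dotC y) dotZl. Qed.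
Lemma dotBr x y z : dot z (fun i => x i - y i) = dot z x - dot z y.
Proof. by rewrite !(dotC z) dotBl. Qed.

Lemma dot_ge0 x : 0 <= dot x x.
Proof. by elim: n x => [|m IHm] x //=; rewrite addr_ge0 // -expr2 sqr_ge0. Qed.

Lemma dot_sub_scale t x y : dot (fun i => x i - t * y i) (fun i => x i - t * y i) =
  dot x x - 2 * t * dot x y + t ^+ 2 * dot y y.
Proof.
rewrite (dotBl x (fun i => t * y i)) !(dotBr x (fun i => t * y i)).
by rewrite !(dotZl t y) !(dotZr t y) (dotC y x); ring.
Qed.

Lemma dot_sub_le x y : dot (fun i => x i - y i) (fun i => x i - y i) <=
  2 * dot x x + 2 * dot y y.
Proof.
have := dot_ge0 (fun i => x i + y i).
by rewrite dotDl !(dotDr x y) (dotBl x y) !(dotBr x y) (dotC y x); lra.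
Qed.
End Dot.

Lemma sqr_le_dot n (x : rvec n) i : x i ^+ 2 <= dot x x.
Proof.
elim: n x i => [|m IHm] x i; first by inversion i.
apply: (Fin.caseS' i (fun i => x i ^+ 2 <= dot x x)) => [|j] /=.
  by rewrite -expr2 lerDl dot_ge0.
by apply: le_trans (IHm (vec_tail x) j) _; rewrite lerDr -expr2 sqr_ge0.
Qed.

Lemma dot_le n (x : rvec n) M : (forall i, `|x i| <= M) -> dot x x <= n%:R * M ^+ 2.
Proof.
elim: n x => [|m IHm] x h /=; first by rewrite mul0r.
rewrite -addn1 natrD mulrDl mul1r addrC lerD ?IHm //; first by move=> i; exact: h.
have hM := le_trans (normr_ge0 _) (h Fin.F1).
by rewrite -expr2 -(real_normK (num_real _)) ler_pXn2r ?nnegrE.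
Qed.

Lemma mev_sqnorm n (x : rvec n) : mev x (sqnorm R n) = dot x x.
Proof.
elim: n x => [|m IHm] x; first exact: rmorph0.
rewrite [sqnorm _ _]/= rmorphD rmorphXn [mev x 'X]mevS map_polyX hornerX mevC IHm.
by rewrite expr2.
Qed.

Lemma polyk_tail n k f : polyk n k f -> polyk n.+1 k (fun x => f (vec_tail x)).
Proof.
elim=> {k f} [k c|k i k1|k f g _ hf _ hg|k a b f g _ hf _ hg ab].
- exact: polyk_const.
- exact: polyk_var.
- exact: polyk_add hf hg.
- exact: polyk_mul hf hg ab.
Qed.

Lemma polyk_dot n (a : rvec n) : polyk n 1 (fun x => dot a x).
Proof.
elim: n a => [|m IHm] a /=; first exact: polyk_const.
apply: (polyk_add m.+1 1 (fun x => Rmult (a Fin.F1) (x Fin.F1))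
  (fun x => dot (vec_tail a) (vec_tail x))).
  apply: (polyk_mul m.+1 1 0 1 (fun=> a Fin.F1)) => //.
    exact: polyk_const.
  exact: polyk_var.
exact: polyk_tail (IHm (vec_tail a)).
Qed.

Inductive sos (B : comNzRingType) : B -> Prop :=
  | sos0 : sos 0
  | sosD (h f : B) : sos f -> sos (h ^+ 2 + f).

Section SumOfSquares.
Variable B : comNzRingType.
Implicit Types f g h : B.

Lemma sos_add f g : sos f -> sos g -> sos (f + g).
Proof.
move=> + Sg; elim=> [|h {}f _ IHf]; first by rewrite add0r.
by rewrite -addrA; exact: sosD.
Qed.

Lemma sos_mul f g : sos f -> sos g -> sos (f * g).
Proof.
move=> + Sg; elim=> [|h {}f _ IHf]; first by rewrite mul0r; exact: sos0.
rewrite mulrDl; apply: sos_add IHf.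
elim: Sg => [|k {}g _ IHg]; first by rewrite mulr0; exact: sos0.
by rewrite mulrDr -exprMn; exact: sosD.
Qed.

Lemma sos_sqr h : sos (h ^+ 2).
Proof. by rewrite -[h ^+ 2]addr0; apply: sosD; exact: sos0. Qed.
End SumOfSquares.

(** * The preorder of sums of squares modulo the ideal *)

Section SosModulo.
Variables (n : nat) (I : (point n -> R) -> Prop).
Hypothesis Iideal : is_ideal n I.

Definition mideal (m : rpoly n) := I (fun x => mev x m).

Definition sos_mod (m : rpoly n) := exists u, sos u /\ mideal (m - u).

Lemma mideal0 : mideal 0.
Proof.
rewrite /mideal (_ : (fun _ => _) = (fun=> (0 : R))); first exact: ideal_0 Iideal.
by apply/funext => x; rewrite rmorph0.
Qed.

Lemma midealD a b : mideal a -> mideal b -> mideal (a + b).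
Proof.
move=> Ia Ib; have := ideal_add _ _ Iideal _ _ Ia Ib; rewrite /mideal.
by congr I; apply/funext => x; rewrite rmorphD.
Qed.

Lemma midealMl a b : mideal b -> mideal (a * b).
Proof.
move=> Ib; have := ideal_mul _ _ Iideal _ _ (is_poly_mev a) Ib; rewrite /mideal.
by congr I; apply/funext => x; rewrite rmorphM.
Qed.

Lemma sos_mod_preorder : preorder sos_mod.
Proof.
split.
- move=> x y [u [Su Iu]] [v [Sv Iv]]; exists (u + v); split; first exact: sos_add.
  by rewrite opprD addrACA; exact: midealD.
- move=> x y [u [Su Iu]] [v [Sv Iv]]; exists (u * v); split; first exact: sos_mul.
  have -> : x * y - u * v = y * (x - u) + u * (y - v) by ring.
  by apply: midealD; exact: midealMl.
- move=> x; exists (x ^+ 2); split; first exact: sos_sqr.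
  by rewrite subrr; exact: mideal0.
Qed.

Lemma mideal_sos_mod m : mideal m -> sos_mod m /\ sos_mod (- m).
Proof.
move=> Im; split; exists 0; rewrite subr0; split; do ?exact: sos0; first by [].
by rewrite -mulN1r; exact: midealMl.
Qed.

Lemma VR_mideal z : VR n I z <-> forall m, mideal m -> mev z m = 0.
Proof.
split=> [Vz m Im|h f If]; first exact: Vz Im.
have [k /polyk_mpol[m fE]] := ideal_poly _ _ Iideal _ If.
by rewrite fE; apply: h; rewrite /mideal -fE.
Qed.

Lemma ksos_mod_sos_mod m : sos_mod m -> exists k, ksos_mod n I k (fun x => mev x m).
Proof.
move=> [u [Su Iu]].
have [k [gs [gsk gsE]]] : exists (k : nat) gs, (forall g, List.In g gs -> polyk n k g) /\
    forall x, sum_sq n gs x = mev x u.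
  elim: Su => [|h f _ [k [gs [gsk gsE]]]]; first by exists 0%N, nil; split=> // x; rewrite rmorph0.
  have [j hj] := is_poly_mev h.
  exists (maxn j k), ((fun x => mev x h) :: gs); split.
    move=> g [<-|/gsk gk]; first exact: polyk_le hj (leq_maxl _ _).
    exact: polyk_le gk (leq_maxr _ _).
  by move=> x; rewrite rmorphD rmorphXn /= gsE RmultE RplusE expr2.
exists k, gs; split=> //; move: Iu; rewrite /mideal; congr I.
by apply/funext => x; rewrite gsE rmorphB.
Qed.

Lemma compact_bound : is_compact n (VR n I) ->
  exists2 N, 0 <= N & forall z, VR n I z -> dot z z < N.
Proof.
(* Open sup-norm boxes; the slack [e], common to all coordinates, makes openness immediate. *)
pose U (k : nat) (x : point n) := exists2 e : R, 0 < e & forall i, `|x i| + e < k%:R.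
move=> /(_ nat U)[k x [e e0 xe]|x _|ks ksP].
- exists (e / 2); split; first by apply/RltP; rewrite divr_gt0.
  move=> y yx; exists (e / 2); first by rewrite divr_gt0.
  move=> i; have /RltP := yx i; rewrite RabsE RminusE => yi.
  apply: le_lt_trans (xe i).
  have : `|y i| <= `|x i| + `|y i - x i| by rewrite -{1}(subrK (x i) (y i)) addrC ler_normD.
  lra.
(* From (|x_i| - 1)^2 >= 0 and x_i^2 <= |x|^2 follows |x_i| + 1 <= |x|^2 + 2. *)
- exists (Num.truncn (dot x x + 2)).+1, 1 => // i.
  apply: le_lt_trans (truncnS_gt _).
  have h := sqr_le_dot x i; rewrite -(real_normK (num_real _)) in h.
  have := sqr_ge0 (`|x i| - 1); have := dot_ge0 x; rewrite sqrrB1; lra.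
- pose K := foldr maxn 0%N ks.
  have KP k : List.In k ks -> (k <= K)%N.
    rewrite /K; elim: ks {ksP K} => [|a ks IHks] //= [->|/IHks h].
      exact: leq_maxl.
    by rewrite (leq_trans h) // leq_maxr.
  exists (n%:R * K%:R ^+ 2 + 1); first by rewrite addr_ge0 // mulr_ge0 ?sqr_ge0.
  move=> z /ksP[k [/KP kK [e e0 ze]]]; suff h : dot z z <= n%:R * K%:R ^+ 2.
    by rewrite (le_lt_trans h) // ltrDl.
  apply: dot_le => i; apply: ltW; apply: lt_le_trans (_ : k%:R <= _); last by rewrite ler_nat.
  by apply: lt_trans (ze i); rewrite ltrDl.
Qed.

Lemma positive_sos_mod m : is_compact n (VR n I) ->
  (forall z, VR n I z -> 0 < mev z m) -> sos_mod m.
Proof.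
move=> /compact_bound[N N0 NP] mpos.
have pss f : (forall z, VR n I z -> 0 < mev z f) ->
    exists s t, [/\ sos_mod s, sos_mod t & t * f = 1 + s].
  move=> fpos; apply: (positivstellensatz sos_mod_preorder mideal_sos_mod).
  by move=> z /VR_mideal; exact: fpos.
have [|s [t [Ts Tt e]]] := pss (mcst R n N - sqnorm R n).
  by move=> z /NP zN; rewrite rmorphB mev_mcst mev_sqnorm subr_gt0.
have [s' [t' [Ts' Tt' e']]] := pss m mpos.
apply: archimedean_mem sos_mod_preorder _ Ts' Tt' e'.
exact: bounded_all_of_certificate sos_mod_preorder N0 Tt Ts e.
Qed.

End SosModulo.

(** * Separation and the main theorem *)

Lemma conv_segment n (V : point n -> Prop) q x t : conv n V q -> V x ->
  0 <= t <= 1 -> conv n V (fun i => q i + t * (x i - q i)).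
Proof.
move=> [l [lP [l1 lE]]] Vx /andP[t0 t1].
exists ((t, x) :: List.map (fun c => ((1 - t) * fst c, snd c)) l); split.
  move=> c [<-|/List.in_map_iff[d [<- /lP[/RleP d0 Vd]]]] /=.
    by split=> //; exact/RleP.
  by split=> //; apply/RleP; rewrite mulr_ge0 // subr_ge0.
split=> [|i] /=; rewrite ?RplusE ?RmultE.
  have -> : List.fold_right (fun c acc => Rplus (fst c) acc) (IZR 0)
      (List.map (fun c : R * point n => ((1 - t) * fst c, snd c)) l) = (1 - t) * IZR 1.
    rewrite -l1; elim: l {lP l1 lE} => [|c l IHl] /=; first by rewrite mulr0.
    by rewrite !RplusE mulrDr IHl.
  by rewrite R1E mulr1 addrC subrK.
have -> : List.fold_right (fun c acc => Rplus (Rmult (fst c) (snd c i)) acc) (IZR 0)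
    (List.map (fun c : R * point n => ((1 - t) * fst c, snd c)) l) = (1 - t) * q i.
  rewrite lE; elim: l {lP l1 lE} => [|c l IHl] /=; first by rewrite mulr0.
  by rewrite !RplusE !RmultE mulrDr IHl mulrA.
by ring.
Qed.

Lemma conv_point n (V : point n -> Prop) x : V x -> conv n V x.
Proof.
move=> Vx; exists ((1 : R, x) :: nil); split.
  by move=> c [<-|[]]; split=> //; apply/RleP.
by split=> [|i] /=; rewrite ?RplusE ?RmultE addr0 ?mul1r.
Qed.

Definition dist2 n (x y : rvec n) := dot (fun i => x i - y i) (fun i => x i - y i).

(** A failing candidate is replaced by one whose squared distance is smaller by more than [eta];
    nonnegativity ends the process. No minimum over the convex hull has to be attained. *)
Lemma almost_nearest n (S : rvec n -> Prop) p q0 (eta : R) : 0 < eta -> S q0 ->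
  exists q, [/\ S q, dist2 p q <= dist2 p q0 &
    forall q', S q' -> dist2 p q <= dist2 p q' + eta].
Proof.
move=> eta0 Sq0.
suff H k : forall q, S q -> dist2 p q <= dist2 p q0 -> dist2 p q <= k%:R * eta ->
    exists q, [/\ S q, dist2 p q <= dist2 p q0 &
    forall q', S q' -> dist2 p q <= dist2 p q' + eta].
  apply: (H (Num.truncn (dist2 p q0 / eta)).+1 q0) => //.
  by rewrite -ler_pdivrMr // ltW // truncnS_gt.
elim: k => [|k IHk] q Sq qq0 qk.
  exists q; split=> // q' _; rewrite mul0r in qk; apply: le_trans qk _.
  by apply: addr_ge0; [exact: dot_ge0|exact: ltW].
have [h|] := pselect (forall q', S q' -> dist2 p q <= dist2 p q' + eta).
  by exists q.
move=> /existsNP[q' /not_implyP[Sq' /negP]]; rewrite -ltNge => lt.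
apply: (IHk q' Sq').
  by apply: le_trans qq0; apply: ltW; apply: le_lt_trans lt; rewrite lerDl ltW.
move: qk; rewrite -addn1 natrD mulrDl mul1r => qk.
by have := lt_le_trans lt qk; rewrite ltrD2r => /ltW.
Qed.

Lemma separation n (V : point n -> Prop) (N : R) p :
  (forall x, V x -> dot x x < N) -> (exists x, V x) -> ~ closure n (conv n V) p ->
  exists l, [/\ polyk n 1 l, forall x, V x -> 0 < l x & l p < 0].
Proof.
move=> VN [x0 Vx0] pcl.
have [e [e0 eP]] : exists e : R, 0 < e /\ forall q, conv n V q -> e <= dist2 p q.
  apply: contrapT => nh; apply: pcl => eps /RltP eps0.
  apply: contrapT => nq; apply: nh; exists (eps ^+ 2); split.
    by rewrite exprn_gt0.
  move=> q Sq; rewrite leNgt; apply/negP => lt; apply: nq; exists q; split=> // i.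
  apply/RltP; rewrite RabsE RminusE -(ltr_pXn2r (n := 2)) ?nnegrE //; last exact: ltW.
  rewrite real_normK ?num_real //; apply: le_lt_trans lt.
  exact: (sqr_le_dot (fun i => p i - q i) i).
(* D bounds |x - q|^2 for x in V, through |q|^2 <= 2 |p|^2 + 2 |p - q|^2 and |p - q|^2 <= A. *)
pose A := dist2 p x0; pose D := 2 * N + 4 * dot p p + 4 * A.
have A0 : 0 <= A by exact: dot_ge0.
have D0 : 0 <= D.
  have := dot_ge0 p; have := le_lt_trans (dot_ge0 x0) (VN _ Vx0); rewrite /D; lra.
(* Chosen so that t <= 1 and t D <= e / 2. *)
pose t := e / (2 * D + 2 * e).
have den0 : 0 < 2 * D + 2 * e by lra.
have tE : t * (2 * D + 2 * e) = e by rewrite /t divfK // gt_eqF.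
have t0 : 0 < t by rewrite /t divr_gt0.
have t1 : t <= 1 by rewrite /t ler_pdivrMr //; lra.
have [q [Sq qA qP]] := almost_nearest p (mulr_gt0 t0 e0) (conv_point Vx0).
pose v : rvec n := fun i => p i - q i.
have vE : dist2 p q = dot v v by [].
(* Moving q towards x by the fraction t stays in the hull, so it lowers the squared distance to p by
   at most t e; dividing by t gives the bound. *)
have key x : V x -> 2 * dot v (fun i => x i - q i) <= e + t * D.
  move=> Vx; pose w : rvec n := fun i => x i - q i.
  have Sq' := conv_segment (t := t) Sq Vx; rewrite ltW //= in Sq'.
  have := qP _ (Sq' t1).
  have -> : dist2 p (fun i => q i + t * (x i - q i)) =
      dot v v - 2 * t * dot v w + t ^+ 2 * dot w w.
    rewrite -dot_sub_scale /dist2.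
    have -> // : (fun i => p i - (q i + t * (x i - q i))) = (fun i => v i - t * w i).
    by apply/funext => i; rewrite /v /w opprD addrA.
  rewrite vE => h.
  have wD : dot w w <= D.
    have h1 : dot w w <= 2 * dot x x + 2 * dot q q by exact: dot_sub_le.
    have h2 : dot q q <= 2 * dot p p + 2 * dot v v.
      have -> : q = (fun i => p i - v i) by apply/funext => i; rewrite /v subKr.
      exact: dot_sub_le.
    have h3 := ltW (VN x Vx); rewrite vE in qA; rewrite /D /A; lra.
  have : t * (2 * dot v w) <= t * (e + t * D).
    have : t ^+ 2 * dot w w <= t ^+ 2 * D by rewrite ler_wpM2l // sqr_ge0.
    rewrite expr2 in h *; lra.
  by rewrite ler_pM2l.
have tD : t * D <= e / 2.
  have : 0 <= t * e by rewrite mulr_ge0 // ltW.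
  move: tE; lra.
have vp : dot v p - dot v q = dot v v by rewrite -dotBr.
have {key}key x : V x -> 2 * (dot v x - dot v q) <= e + t * D.
  by move=> /key; rewrite (dotBr x q v).
have {vE}ev : e <= dot v v by rewrite -vE eP.
(* On V, v . (x - q) is at most 3 e / 4, whereas v . (p - q) >= e; the threshold 7 e / 8 lies
   strictly between. *)
clearbody v; exists (fun x => Rplus (dot (fun i => -1 * v i)%R x) (dot v q + e * (7 / 8))%R).
split.
- by apply: polyk_add; [exact: polyk_dot|exact: polyk_const].
- by move=> x /key; rewrite RplusE (dotZl (-1) v); lra.
- by rewrite RplusE (dotZl (-1) v); lra.
Qed.

Lemma polyk0_const n f : polyk n 0 f -> exists c, f = (fun=> c).
Proof.
suff H k : polyk n k f -> k = 0%N -> exists c, f = (fun=> c) by move/H; apply.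
elim=> {k f}.
- by move=> k c _; exists c.
- by move=> k i k1 k0; lia.
- by move=> k f g _ hf _ hg k0; have [a ->] := hf k0; have [b ->] := hg k0; exists (Rplus a b).
- move=> k a b f g _ hf _ hg ab k0.
  have [c ->] := hf ltac:(lia); have [d ->] := hg ltac:(lia).
  by exists (Rmult c d).
Qed.

Lemma polyk1_affine n f : polyk n 1 f ->
  exists a b, forall x, f x = dot a x + b.
Proof.
suff H k : polyk n k f -> (k <= 1)%N -> exists a b, forall x, f x = dot a x + b.
  by move/H; apply.
elim=> {k f}.
(* The zero vector is written as a multiple so that [dotZl] evaluates the product. *)
- move=> k c _; exists (fun=> 0 * 0), c => x.
  by rewrite (dotZl 0 (fun=> 0)) mul0r add0r.
- move=> k i _ _; elim: n i => [|n IHn] i; first by inversion i.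
  apply: (Fin.caseS' i (fun i => exists a b, forall x : rvec n.+1, x i = dot a x + b)).
    exists (vec_cons 1 (fun=> 0 * 0)), 0 => x /=.
    have -> : vec_tail (vec_cons 1 (fun _ : Fin.t n => 0 * 0 : R)) = (fun=> 0 * 0) by [].
    by rewrite (dotZl 0 (fun=> 0)) mul0r !addr0 /vec_cons /= mul1r.
  move=> j; have [a [b abP]] := IHn j; exists (vec_cons 0 a), b => x /=.
  by rewrite mul0r add0r -abP.
- move=> k f g _ hf _ hg k1; have [a [b h]] := hf k1; have [a' [b' h']] := hg k1.
  exists (fun i => a i + a' i), (b + b') => x.
  by rewrite h h' RplusE dotDl addrACA.
(* Since a + b <= 1, one of the factors has degree 0 and is constant. *)
- move=> k a b f g hf0 hf hg0 hg ab k1.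
  have [a0|a0] := posnP a.
    rewrite a0 in hf0; have [c ->] := polyk0_const hf0.
    have [|v [d h]] := hg; first by lia.
    by exists (fun i => c * v i), (c * d) => x; rewrite h RmultE dotZl; ring.
  have b0 : b = 0%N by lia.
  rewrite b0 in hg0; have [c ->] := polyk0_const hg0.
  have [|v [d h]] := hf; first by lia.
  by exists (fun i => c * v i), (c * d) => x; rewrite h RmultE dotZl; ring.
Qed.

Lemma affine_conv_ge0 n (V : point n -> Prop) (a : rvec n) (b : R) :
  (forall x, V x -> 0 <= dot a x + b) -> forall q, conv n V q -> 0 <= dot a q + b.
Proof.
move=> VP q [l [lP [l1 lE]]].
suff -> : dot a q + b =
    List.fold_right (fun c acc => fst c * (dot a (snd c) + b) + acc) 0 l.
  elim: l {l1 lE} lP => [|c l IHl] lP //=.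
  have [/RleP c0 Vc] := lP c (or_introl erefl).
  rewrite addr_ge0 //; first by rewrite mulr_ge0 // VP.
  by apply: IHl => d dl; apply: lP; right.
(* With 1 replaced by the sum of the weights, both sides become folds over [l]. *)
have -> : dot a q + b = dot a q + IZR 1 * b by rewrite R1E mul1r.
rewrite -l1.
have -> : q = (fun i => List.fold_right
    (fun c acc => Rplus (Rmult (fst c) (snd c i)) acc) (IZR 0) l).
  by apply/funext => i; exact: lE.
elim: l {lP l1 lE} => [|c l IHl] /=.
  rewrite (_ : (fun=> IZR 0) = (fun=> 0 * (0 : R))); last first.
    by apply/funext => i; rewrite mul0r.
  by rewrite (dotZr 0 (fun=> 0)) !mul0r addr0.
rewrite -IHl !RplusE (dotDr (fun i => c.1 * c.2 i)) dotZr; ring.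
Qed.

Lemma dot_closure n (S : point n -> Prop) (a : rvec n) (b : R) p :
  closure n S p -> (forall q, S q -> 0 <= dot a q + b) -> 0 <= dot a p + b.
Proof.
move=> clp Sge; rewrite leNgt; apply/negP => neg.
pose m := - (dot a p + b); have m0 : 0 < m by rewrite oppr_gt0.
(* In place of Cauchy-Schwarz, |w - e a|^2 >= 0 gives 2 (a . w) <= e A <= m, so the form would still
   be negative at q. *)
pose A := dot a a + n%:R + 1.
have A0 : 0 < A by rewrite ltr_wpDl // addr_ge0 // dot_ge0.
pose e := Num.min 1 (m / A).
have e0 : 0 < e by rewrite lt_min ltr01 divr_gt0.
have [q [Sq qP]] := clp e ltac:(exact/RltP).
pose w : rvec n := fun i => q i - p i.
have wi i : `|w i| <= e.
  by have /RltP := qP i; rewrite RabsE RminusE distrC => /ltW.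
have ww : dot w w <= n%:R * e ^+ 2 by exact: dot_le.
have := Sge q Sq.
have -> : dot a q = dot a p + dot a w by rewrite (dotBr q p a) addrC subrK.
clearbody w.
have : 0 <= dot (fun i => w i - e * a i) (fun i => w i - e * a i) by exact: dot_ge0.
rewrite (dot_sub_scale e w a) (dotC w a) => h.
have eA : e * A <= m by rewrite -ler_pdivlMr // ge_min lexx orbT.
have h2 : e * (2 * dot a w) <= e * (e * A).
  by have := sqr_ge0 e; rewrite /A expr2 in ww h *; lra.
by rewrite ler_pM2l // in h2; rewrite /m in eA; rewrite /m in m0; lra.
Qed.

Lemma sum_sq_ge0 n gs x : 0 <= sum_sq n gs x.
Proof.
by elim: gs => [|g gs IHgs] //=; rewrite RplusE RmultE addr_ge0 // -expr2 sqr_ge0.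
Qed.

Theorem mainTheorem10 (n : nat) (I : (point n -> R) -> Prop) :
  is_ideal n I ->
  is_compact n (VR n I) ->
  forall p : point n,
    (forall k : nat, TH n k I p) <-> closure n (conv n (VR n I)) p.
Proof.
move=> Iideal cpt p; split=> [THp|clp k l l1 [gs [_ lgs]]]; last first.
  apply/RleP; have [a [b lE]] := polyk1_affine l1.
  rewrite lE; apply: dot_closure clp _ => q; apply: affine_conv_ge0 => x Vx.
  rewrite -lE; have /eqP := Vx _ lgs; rewrite RminusE subr_eq0 => /eqP ->.
  exact: sum_sq_ge0.
apply: contrapT => pcl.
have [l [l1 lpos lneg]] : exists l, [/\ polyk n 1 l,
    forall x, VR n I x -> 0 < l x & l p < 0].
  have [Vne|Vempty] := pselect (exists x, VR n I x).
    have [N _ NP] := compact_bound cpt; exact: separation NP Vne pcl.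
  (* An empty variety offers no hull point from which to separate, and -1 is vacuously positive on
     it. *)
  exists (fun=> -1); split; [exact: polyk_const| |by rewrite ltrN10].
  by move=> x Vx; case: Vempty; exists x.
have [m lE] := polyk_mpol l1.
have [|k ksos] := ksos_mod_sos_mod (m := m) (positive_sos_mod Iideal cpt _).
  by move=> z /lpos; rewrite lE.
by have /RleP := THp k l l1 (eq_ind_r (ksos_mod n I k) ksos lE); rewrite leNgt lneg.
Qed.
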